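(* Let $p,q\ge 0$ and let $f\in\mathfrak{H}_{\mathbb{C}}^{\odot p}\otimes\mathfrak{H}_{\mathbb{C}}^{\odot q}$ have the expansion $$f=\sum_{\mathbf{p},\mathbf{q}\in\Lambda,\,|\mathbf{p}|=p,\,|\mathbf{q}|=q} c(\mathbf{p};\mathbf{q})\,\mathrm{symm}\Big(\otimes_{k=1}^{\infty}e_k^{\otimes p_k}\Big)\otimes\mathrm{symm}\Big(\otimes_{k=1}^{\infty}\overline{e}_k^{\otimes q_k}\Big),$$ where $c(\mathbf{p};\mathbf{q})\in\mathbb{C}$ is the unique family of coefficients, satisfying $\sum_{|\mathbf{p}|=p,|\mathbf{q}|=q}|c(\mathbf{p};\mathbf{q})|^2<\infty$, for which this holds. Then $\mathcal{I}_{p,q}(f)$ admits the unique representation $$\begin{aligned}\mathcal{I}_{p,q}(f)&=\sum_{\mathbf{p},\mathbf{q}\in\Lambda,|\mathbf{p}|=p,|\mathbf{q}|=q} I_{p+q}\big(\mathrm{Re}(c(\mathbf{p};\mathbf{q}))\,u(\mathbf{p},\mathbf{q})-\mathrm{Im}(c(\mathbf{p};\mathbf{q}))\,v(\mathbf{p},\mathbf{q})\big)\\&\quad+\mathrm{i}\sum_{\mathbf{p},\mathbf{q}\in\Lambda,|\mathbf{p}|=p,|\mathbf{q}|=q} I_{p+q}\big(\mathrm{Im}(c(\mathbf{p};\mathbf{q}))\,u(\mathbf{p},\mathbf{q})+\mathrm{Re}(c(\mathbf{p};\mathbf{q}))\,v(\mathbf{p},\mathbf{q})\big),\end{aligned}$$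 where $I_{p+q}(\cdot)$ is the real $(p+q)$-th Wiener-Itô integral with respect to $W$, the series converge in $L^2(\Omega)$, and uniqueness means that the kernels in $(\mathfrak{H}\oplus\mathfrak{H})^{\odot(p+q)}$ of the real and imaginary parts of $\mathcal{I}_{p,q}(f)$ are uniquely determined.
   Context: $\mathfrak{H}$ is a real separable Hilbert space, $\mathfrak{H}_{\mathbb{C}}$ its complexification (inner product linear in the first variable), $\mathfrak{H}\oplus\mathfrak{H}$ the Hilbert direct sum; $^{\odot n}$ is the $n$-th symmetric tensor power, $\mathrm{symm}$ the symmetrization. $X$, $Y$ are two independent isonormal Gaussian processes over $\mathfrak{H}$ (centered Gaussian families with $\mathbb{E}[X(h)X(g)]=\langle h,g\rangle_{\mathfrak{H}}$, likewise $Y$). $W(h,f)=X(h)+Y(f)$ is an isonormal Gaussian process over $\mathfrak{H}\oplus\mathfrak{H}$. For $\mathfrak{h}=f+\mathrm{i}g\in\mathfrak{H}_{\mathbb{C}}$ put $X_{\mathbb{C}}(\mathfrak{h})=X(f)+\mathrm{i}X(g)$, similarly $Y_{\mathbb{C}}$, and $Z(\mathfrak{h})=(X_{\mathbb{C}}(\mathfrak{h})+\mathrm{i}Y_{\mathbb{C}}(\mathfrak{h}))/\sqrt2$ (complex isonormal Gaussian process). $\Lambda$ is the set of sequences $\mathbf{a}=\{a_k\}_{k\ge1}$ of non-negative integers with finite sum $|\mathbf{a}|=\sum_k a_k$; $\mathbf{a}!=\prod_k a_k!$; $\mathbf{a}\le\mathbf{b}$ and $\mathbf{a}+\mathbf{b}$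 are componentwise. Real integrals: Hermite polynomials are defined by $\exp\{tx-t^2/2\}=\sum_n \frac{t^n}{n!}H_n(x)$. For a complete orthonormal system $\{\eta_k\}$ of $\mathfrak{H}\oplus\mathfrak{H}$, $I_n$ is the linear isometry from $(\mathfrak{H}\oplus\mathfrak{H})^{\odot n}$ with norm $\sqrt{n!}\|\cdot\|$ onto the $n$-th Wiener chaos of $W$ given by $I_n(\mathrm{symm}(\otimes_k\eta_k^{\otimes m_k}))=\prod_kH_{m_k}(W(\eta_k))$, $|\mathbf{m}|=n$; $I_0$ is the identity. Complex integrals: complex Hermite polynomials are defined by $\exp\{\lambda\bar z+\bar\lambda z-2|\lambda|^2\}=\sum_{p,q\ge0}\frac{\bar\lambda^p\lambda^q}{p!q!}J_{p,q}(z)$. For a complete orthonormal system $\{\xi_k\}$ of $\mathfrak{H}_{\mathbb{C}}$, $\mathcal{I}_{p,q}$ is the linear isometry from $\mathfrak{H}_{\mathbb{C}}^{\odot p}\otimes\mathfrak{H}_{\mathbb{C}}^{\odot q}$ with norm $\sqrt{p!q!}\|\cdot\|$ into $L^2_{\mathbb{C}}(\Omega)$ given by $\mathcal{I}_{p,q}(\mathrm{symm}(\otimes_k\xi_k^{\otimes p_k})\otimes\mathrm{symm}(\otimes_k\overline{\xi}_k^{\otimes q_k}))=\prod_k2^{-(p_k+q_k)/2}J_{p_k,q_k}(\sqrt2Z(\xi_k))$, $|\mathbf p|=p,|\mathbf q|=q$. $\{e_k=e_k^1+\mathrm{i}e_k^2\}_{k\ge1}$ ($e_k^1,e_k^2\in\mathfrak{H}$)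 is a complete orthogonal system in $\mathfrak{H}_{\mathbb{C}}$ with $\|e_k\|=\sqrt2$; $u_{1,0}(k)=\frac1{\sqrt2}(e_k^1,-e_k^2)$, $v_{1,0}(k)=\frac1{\sqrt2}(e_k^2,e_k^1)$ in $\mathfrak{H}\oplus\mathfrak{H}$. For $\mathbf{p},\mathbf{q}\in\Lambda$ with $|\mathbf{p}|=p,|\mathbf{q}|=q$ put $a_{k,j}=\mathrm{i}^{p_k+q_k-j}\sum_{r+s=j}\binom{p_k}{r}\binom{q_k}{s}(-1)^{q_k-s}$ and $$u(\mathbf{p},\mathbf{q})=\sum_{\mathbf{j}\le\mathbf{p}+\mathbf{q}}\mathrm{Re}\Big(\prod_{l=1}^\infty a_{l,j_l}\Big)\mathrm{symm}\Big(\otimes_{k=1}^\infty\big(u_{1,0}(k)^{\otimes j_k}\otimes v_{1,0}(k)^{\otimes(p_k+q_k-j_k)}\big)\Big),$$ $$v(\mathbf{p},\mathbf{q})=\sum_{\mathbf{j}\le\mathbf{p}+\mathbf{q}}\mathrm{Im}\Big(\prod_{l=1}^\infty a_{l,j_l}\Big)\mathrm{symm}\Big(\otimes_{k=1}^\infty\big(u_{1,0}(k)^{\otimes j_k}\otimes v_{1,0}(k)^{\otimes(p_k+q_k-j_k)}\big)\Big),$$ where $\mathbf{j}$ ranges over $\Lambda$. *)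

(* Defs.v *)
From HB Require Import structures.
From mathcomp Require Import all_boot all_order all_algebra finmap perm complex.
From mathcomp Require Import all_classical all_reals all_analysis.
From mathcomp Require Import showcase.summability ring lra.

Set Implicit Arguments.
Unset Strict Implicit.
Unset Printing Implicit Defensive.

Import Order.TTheory GRing.Theory Num.Theory.
Import numFieldNormedType.Exports.

Local Open Scope classical_set_scope.
Local Open Scope ring_scope.
Local Open Scope complex_scope.

(* With [theta] the identity (resp. the conjugation) of the scalars, a real
   (resp. complex) Hilbert space. [inner] is linear in its first argument. *)
HB.mixin Record CompleteNormedModule_isHilbert (K : numFieldType)
    (theta : K -> K) V & CompleteNormedModule K V := {
  inner : {dot V for theta};
  inner_norm : forall x : V, inner x x = `|x| ^+ 2
}.

#[short(type="hilbertType")]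
HB.structure Definition Hilbert (K : numFieldType) (theta : K -> K) :=
  {V of CompleteNormedModule K V & CompleteNormedModule_isHilbert K theta V}.

Arguments inner {K theta s}.

Local Notation Re := complex.Re.
Local Notation Im := complex.Im.

Notation realHilbertType R := (@Hilbert.type R idfun).
Notation complexHilbertType R := (@Hilbert.type R[i] Num.conj).

Section norm2.
Context {R : realType}.
Implicit Types a b : R.

Definition norm2 a b : R := Num.sqrt (a ^+ 2 + b ^+ 2).

Lemma norm2_ge0 a b : 0 <= norm2 a b. Proof. exact: sqrtr_ge0. Qed.

Lemma norm2_sqr a b : norm2 a b ^+ 2 = a ^+ 2 + b ^+ 2.
Proof. by rewrite sqr_sqrtr// addr_ge0// sqr_ge0. Qed.

Lemma norm2_eq0 a b : norm2 a b = 0 -> a = 0 /\ b = 0.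
Proof.
move=> ab0; have /eqP := norm2_sqr a b.
rewrite ab0 expr0n/= eq_sym paddr_eq0 ?sqr_ge0// !sqrf_eq0.
by move=> /andP[/eqP-> /eqP->].
Qed.

Lemma le_norm2 a b a' b' : 0 <= a -> 0 <= b -> a <= a' -> b <= b' ->
  norm2 a b <= norm2 a' b'.
Proof.
move=> a0 b0 aa' bb'; rewrite ler_wsqrtr// lerD// lerXn2r// nnegrE//.
- exact: le_trans aa'.
- exact: le_trans bb'.
Qed.

Lemma le_norm2D a b a' b' :
  norm2 (a + a') (b + b') <= norm2 a b + norm2 a' b'.
Proof.
have := ler_normD (a +i* b) (a' +i* b').
have -> : (a +i* b) + (a' +i* b') = (a + a') +i* (b + b') by [].
by rewrite !normc_def/= -rmorphD/= lecR.
Qed.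

Lemma norm2Ml k a b : 0 <= k -> norm2 (k * a) (k * b) = k * norm2 a b.
Proof.
move=> k0; rewrite /norm2 !exprMn -mulrDr sqrtrM ?sqr_ge0//.
by rewrite sqrtr_sqr ger0_norm.
Qed.

Lemma le_norm2l a b : `|a| <= norm2 a b.
Proof. by rewrite -sqrtr_sqr ler_wsqrtr// lerDl sqr_ge0. Qed.

Lemma le_norm2r a b : `|b| <= norm2 a b.
Proof. by rewrite -sqrtr_sqr ler_wsqrtr// lerDr sqr_ge0. Qed.

Lemma norm2_leD a b : 0 <= a -> 0 <= b -> norm2 a b <= a + b.
Proof.
move=> a0 b0; rewrite -(@ler_pXn2r _ 2) ?nnegrE ?norm2_ge0 ?addr_ge0//.
by rewrite norm2_sqr sqrrD -addrA lerD2l lerDr mulrn_wge0// mulr_ge0.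
Qed.

End norm2.

(* The Hilbert direct sum: the canonical norm of the product type is the
   sup norm, hence the alias. *)
Definition dsum {R : realType} (U V : realHilbertType R) : Type := (U * V)%type.

Section dsum.
Context {R : realType} (U V : realHilbertType R).
Local Notation W := (dsum U V).

HB.instance Definition _ := GRing.Lmodule.copy W (U * V)%type.

Definition dsum_norm (x : W) : R := norm2 `|x.1| `|x.2|.

Lemma dsum_normD x y : dsum_norm (x + y) <= dsum_norm x + dsum_norm y.
Proof.
apply: le_trans (le_norm2D _ _ _ _).
by apply: le_norm2 => //; exact: ler_normD.
Qed.

Lemma dsum_normZ (l : R) x : dsum_norm (l *: x) = `|l| * dsum_norm x.
Proof. by rewrite /dsum_norm !normrZ norm2Ml. Qed.

Lemma dsum_norm_eq0 x : dsum_norm x = 0 -> x = 0.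
Proof. by case: x => a b /norm2_eq0[/normr0_eq0/= -> /normr0_eq0/= ->]. Qed.

HB.instance Definition _ :=
  Lmodule_isNormed.Build R W dsum_normD dsum_normZ dsum_norm_eq0.

Lemma dsum_complete (F : set_system W) : ProperFilter F -> cauchy F -> cvg F.
Proof.
move=> FF /cauchyP Fc.
have c1 : cvg ((fst : W -> U) @ F).
  apply: cauchy_cvg; apply/cauchyP => e e0; have [x xF] := Fc _ e0.
  exists x.1; apply: (@filterS _ F _ (ball x e)) xF => y; rewrite -!ball_normE/=.
  have := le_norm2l `|x.1 - y.1| `|x.2 - y.2|; rewrite normr_id.
  exact: le_lt_trans.
have c2 : cvg ((snd : W -> V) @ F).
  apply: cauchy_cvg; apply/cauchyP => e e0; have [x xF] := Fc _ e0.
  exists x.2; apply: (@filterS _ F _ (ball x e)) xF => y; rewrite -!ball_normE/=.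
  have := le_norm2r `|x.1 - y.1| `|x.2 - y.2|; rewrite normr_id.
  exact: le_lt_trans.
apply/cvg_ex; exists ((lim ((fst : W -> U) @ F), lim ((snd : W -> V) @ F)) : W).
apply/cvgrPdist_lt => e e0.
have e20 : 0 < e / 2 by rewrite divr_gt0.
have /cvgrPdist_lt/(_ _ e20) h1 := c1.
have /cvgrPdist_lt/(_ _ e20) h2 := c2.
near=> x.
apply: le_lt_trans (norm2_leD (normr_ge0 _) (normr_ge0 _)) _.
rewrite (splitr e); apply: ltrD; near: x.
  exact: h1.
exact: h2.
Unshelve. all: by end_near. Qed.
HB.instance Definition _ := Uniform_isComplete.Build W dsum_complete.

Definition dsum_inner (x y : W) : R := inner x.1 y.1 + inner x.2 y.2.

Lemma dsum_innerBl z : zmod_morphism (dsum_inner ^~ z).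
Proof. by move=> x y; rewrite /dsum_inner/= !linearBl/= opprD addrACA. Qed.

Lemma dsum_innerBr z : zmod_morphism (dsum_inner z).
Proof. by move=> x y; rewrite /dsum_inner/= !linearBr/= opprD addrACA. Qed.

Lemma dsum_innerZl z : scalable_for *%R (dsum_inner ^~ z).
Proof. by move=> a x; rewrite /dsum_inner/= !linearZl_LR/= mulrDr. Qed.

Lemma dsum_innerZr z : scalable_for (idfun \; *%R) (dsum_inner z).
Proof. by move=> a x; rewrite /dsum_inner/= !linearZr_LR/= mulrDr. Qed.

HB.instance Definition _ := @isBilinear.Build R W W R *%R (idfun \; *%R)
  dsum_inner dsum_innerBl dsum_innerBr dsum_innerZl dsum_innerZr.

Lemma dsum_innerC (x y : W) :
  dsum_inner x y = (-1) ^+ false * idfun (dsum_inner y x).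
Proof.
rewrite /dsum_inner [inner x.1 y.1]hermC [inner x.2 y.2]hermC/=.
by rewrite !expr0 !mul1r.
Qed.

HB.instance Definition _ :=
  @isHermitianSesquilinear.Build R W false idfun dsum_inner dsum_innerC.

Lemma dsum_inner_norm (x : W) : dsum_inner x x = `|x| ^+ 2.
Proof. by rewrite norm2_sqr /dsum_inner !inner_norm. Qed.

Lemma dsum_inner_gt0 (x : W) : x != 0 -> 0 < dsum_inner x x.
Proof. by move=> x0; rewrite dsum_inner_norm exprn_gt0// normr_gt0. Qed.

HB.instance Definition _ := @isDotProduct.Build R W dsum_inner dsum_inner_gt0.

HB.instance Definition _ :=
  @CompleteNormedModule_isHilbert.Build R idfun W dsum_inner dsum_inner_norm.

End dsum.

(* The complexification: (f, g) stands for f + i g. *)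
Definition cplx {R : realType} (H : realHilbertType R) : Type := (H * H)%type.

Section cplx.
Context {R : realType} (H : realHilbertType R).
Local Notation HC := (cplx H).

HB.instance Definition _ := GRing.Zmodule.copy HC (H * H)%type.

Definition cplx_scale (a : R[i]) (x : HC) : HC :=
  (Re a *: x.1 - Im a *: x.2, Im a *: x.1 + Re a *: x.2).

Lemma cplx_scaleA a b x : cplx_scale a (cplx_scale b x) = cplx_scale (a * b) x.
Proof.
case: a b x => [a a'] [b b'] [f g]; rewrite /cplx_scale/=.
congr pair; rewrite !(scalerDl, scalerBl, scalerDr, scalerBr) !(scalerN, scaleNr, scalerA).
  rewrite !opprD; exact: addrACA.
by rewrite [LHS]addrC addrACA.
Qed.

Lemma cplx_scale1 : left_id 1 cplx_scale.
Proof.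
by move=> [f g]; rewrite /cplx_scale/= !scale1r !scale0r subr0 add0r.
Qed.

Lemma cplx_scaleDr : right_distributive cplx_scale +%R.
Proof.
move=> a [f g] [f' g']; congr pair; rewrite /= !scalerDr; last exact: addrACA.
by rewrite opprD addrACA.
Qed.

Lemma cplx_scaleDl x : {morph cplx_scale^~ x : a b / a + b}.
Proof.
move=> [a a'] [b b']; rewrite /cplx_scale/= !scalerDl opprD.
congr pair; exact: addrACA.
Qed.

HB.instance Definition _ := GRing.Zmodule_isLmodule.Build R[i] HC
  cplx_scaleA cplx_scale1 cplx_scaleDr cplx_scaleDl.

Definition cplx_inner (x y : HC) : R[i] :=
  (inner x.1 y.1 + inner x.2 y.2) +i* (inner x.2 y.1 - inner x.1 y.2).

Definition cplx_norm (x : HC) : R[i] := (norm2 `|x.1| `|x.2|)%:C.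

Lemma cplx_normD x y : cplx_norm (x + y) <= cplx_norm x + cplx_norm y.
Proof.
rewrite /cplx_norm -rmorphD lecR.
apply: le_trans (le_norm2D _ _ _ _).
by apply: le_norm2 => //; exact: ler_normD.
Qed.

Lemma cplx_inner_normE (x : HC) : cplx_inner x x = cplx_norm x ^+ 2.
Proof.
rewrite /cplx_norm -rmorphXn/= norm2_sqr /cplx_inner !inner_norm.
by rewrite [inner x.2 x.1]hermC/= expr0 mul1r subrr.
Qed.

Lemma cplx_innerBl z : zmod_morphism (cplx_inner ^~ z).
Proof.
move=> x y; rewrite /cplx_inner/= !linearBl/=.
by congr Complex; ring.
Qed.

Lemma cplx_innerBr z : zmod_morphism (cplx_inner z).
Proof.
move=> x y; rewrite /cplx_inner/= !linearBr/=.
by congr Complex; ring.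
Qed.

Lemma cplx_innerZl z : scalable_for *%R (cplx_inner ^~ z).
Proof.
move=> [a b] x; rewrite /cplx_inner/= !(linearDl, linearNl, linearZl_LR)/=.
by congr Complex; ring.
Qed.

Lemma cplx_innerC (x y : HC) :
  cplx_inner x y = (-1) ^+ false * Num.conj (cplx_inner y x).
Proof.
rewrite expr0 mul1r /cplx_inner.
rewrite [inner x.1 y.1]hermC [inner x.2 y.2]hermC [inner x.1 y.2]hermC.
rewrite [inner x.2 y.1]hermC/= !expr0 !mul1r.
by congr Complex; ring.
Qed.

Lemma cplx_innerZr z : scalable_for (Num.conj \; *%R) (cplx_inner z).
Proof.
move=> a x; rewrite cplx_innerC cplx_innerZl [in RHS]cplx_innerC/=.
by rewrite !expr0 !mul1r rmorphM.
Qed.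

HB.instance Definition _ := @isBilinear.Build R[i] HC HC R[i] *%R
  (Num.conj \; *%R) cplx_inner
  cplx_innerBl cplx_innerBr cplx_innerZl cplx_innerZr.

HB.instance Definition _ := @isHermitianSesquilinear.Build R[i] HC false
  Num.conj cplx_inner cplx_innerC.

Lemma cplx_norm_ge0 x : 0 <= cplx_norm x.
Proof. by rewrite ler0c norm2_ge0. Qed.

Lemma cplx_normZ (l : R[i]) x : cplx_norm (l *: x) = `|l| * cplx_norm x.
Proof.
apply/eqP; rewrite -(@eqrXn2 _ 2)// ?mulr_ge0 ?cplx_norm_ge0//.
by rewrite exprMn -!cplx_inner_normE cplx_innerZl cplx_innerZr mulrA normCK.
Qed.

Lemma cplx_norm_eq0 x : cplx_norm x = 0 -> x = 0.
Proof. by case: x => a b [/norm2_eq0[/normr0_eq0/= -> /normr0_eq0/= ->]]. Qed.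

HB.instance Definition _ :=
  Lmodule_isNormed.Build R[i] HC cplx_normD cplx_normZ cplx_norm_eq0.

Lemma cplx_complete (F : set_system HC) : ProperFilter F -> cauchy F -> cvg F.
Proof.
move=> FF /cauchyP Fc.
have c1 : cvg ((fst : HC -> H) @ F).
  apply: cauchy_cvg; apply/cauchyP => e e0.
  have [|x xF] := Fc e%:C; first by rewrite (ltcR 0 e).
  exists x.1; apply: (@filterS _ F _ (ball x e%:C)) xF => y.
  rewrite -!ball_normE/= ltcR.
  have := le_norm2l `|x.1 - y.1| `|x.2 - y.2|; rewrite normr_id.
  exact: le_lt_trans.
have c2 : cvg ((snd : HC -> H) @ F).
  apply: cauchy_cvg; apply/cauchyP => e e0.
  have [|x xF] := Fc e%:C; first by rewrite (ltcR 0 e).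
  exists x.2; apply: (@filterS _ F _ (ball x e%:C)) xF => y.
  rewrite -!ball_normE/= ltcR.
  have := le_norm2r `|x.1 - y.1| `|x.2 - y.2|; rewrite normr_id.
  exact: le_lt_trans.
apply/cvg_ex.
exists ((lim ((fst : HC -> H) @ F), lim ((snd : HC -> H) @ F)) : HC).
apply/cvgrPdist_lt => -[e e'] /andP[/=/eqP -> e0].
have e20 : 0 < e / 2 by rewrite divr_gt0.
have /cvgrPdist_lt/(_ _ e20) h1 := c1.
have /cvgrPdist_lt/(_ _ e20) h2 := c2.
near=> x.
change ((norm2 `|lim ((fst : HC -> H) @ F) - x.1|
               `|lim ((snd : HC -> H) @ F) - x.2|)%:C < e%:C).
rewrite ltcR; apply: le_lt_trans (norm2_leD (normr_ge0 _) (normr_ge0 _)) _.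
rewrite (splitr e); apply: ltrD; near: x.
  exact: h1.
exact: h2.
Unshelve. all: by end_near. Qed.

HB.instance Definition _ := Uniform_isComplete.Build HC cplx_complete.

Lemma cplx_inner_norm (x : HC) : cplx_inner x x = `|x| ^+ 2.
Proof. exact: cplx_inner_normE. Qed.

Lemma cplx_inner_gt0 (x : HC) : x != 0 -> 0 < cplx_inner x x.
Proof. by move=> x0; rewrite cplx_inner_norm exprn_gt0// normr_gt0. Qed.

HB.instance Definition _ := @isDotProduct.Build R[i] HC cplx_inner cplx_inner_gt0.

HB.instance Definition _ := @CompleteNormedModule_isHilbert.Build R[i]
  Num.conj HC cplx_inner cplx_inner_norm.

End cplx.

Definition cplx_conj {R : realType} {H : realHilbertType R} (x : cplx H) :
  cplx H := (x.1, - x.2).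

Definition lspan {K : pzRingType} {V : lmodType K} (A : set V) : set V :=
  [set x | exists (n : nat) (a : 'I_n -> K) (v : 'I_n -> V),
    (forall i, A (v i)) /\ x = \sum_(i < n) a i *: v i].

Definition separable (T : topologicalType) :=
  exists2 S : set T, countable S & dense S.

Definition complete_orthogonal {K : numFieldType} {theta : K -> K}
    {V : hilbertType theta} (x : nat -> V) :=
  (forall j k, j != k -> inner (x j) (x k) = 0) /\ dense (lspan (range x)).

Definition complete_orthonormal {K : numFieldType} {theta : K -> K}
    {V : hilbertType theta} (x : nat -> V) :=
  complete_orthogonal x /\ forall k, `|x k| = 1.

Definition fupd {V : Type} n (x : 'I_n -> V) (i : 'I_n) (y : V) : 'I_n -> V :=
  fun j => if j == i then y else x j.

(* The (completed) Hilbert tensor power is given by its defining properties,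
   which determine it up to a unitary isomorphism compatible with [tpure];
   tpure x is x_0 (x) ... (x) x_{n-1}. *)
Structure tensor_power {K : numFieldType} {theta : K -> K}
    (V : hilbertType theta) (n : nat) := TensorPower {
  tpower_sort :> hilbertType theta;
  tpure : ('I_n -> V) -> tpower_sort;
  tpure_linear : forall (x : 'I_n -> V) (i : 'I_n) (a : K) (y z : V),
    tpure (fupd x i (a *: y + z)) =
    a *: tpure (fupd x i y) + tpure (fupd x i z);
  tpure_inner : forall x y : 'I_n -> V,
    inner (tpure x) (tpure y) = \prod_(i < n) inner (x i) (y i);
  tpure_total : dense (lspan (range tpure))
}.
Arguments tpure {K theta V n t}.

Structure tensor_product {K : numFieldType} {theta : K -> K}
    (U V : hilbertType theta) := TensorProduct {
  tproduct_sort :> hilbertType theta;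
  tprod : {bilinear U -> V -> tproduct_sort};
  tprod_inner : forall (x x' : U) (y y' : V),
    inner (tprod x y) (tprod x' y') = inner x x' * inner y y';
  tprod_total : dense (lspan [set tprod x y | x in setT & y in setT])
}.
Arguments tprod {K theta U V t}.

Section symmetric.
Context {K : numFieldType} {theta : K -> K} {V : hilbertType theta} {n : nat}.
Variable T : tensor_power V n.

Definition symm (x : 'I_n -> V) : T :=
  n`!%:R^-1 *: \sum_(s : 'S_n) tpure (fun i => x (s i)).

(* Only meaningful when s has size n. *)
Definition symm_seq (s : seq V) : T := symm (fun i => s`_i).

Definition sym_power : set T := closure (lspan (range symm)).

End symmetric.
Arguments symm {K theta V n} T.
Arguments symm_seq {K theta V n} T.
Arguments sym_power {K theta V n} T.

Definition sym_power2 {K : numFieldType} {theta : K -> K}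
    {V : hilbertType theta} {p q : nat} {Tp : tensor_power V p}
    {Tq : tensor_power V q} (S : tensor_product Tp Tq) : set S :=
  closure (lspan [set tprod x y | x in sym_power Tp & y in sym_power Tq]).
Arguments sym_power2 {K theta V p q Tp Tq} S.

(* Sequences are indexed from 0 instead of 1. *)
Notation multi_index := {fsfun nat -> nat with 0%N}.

Definition mi_sum (m : multi_index) : nat :=
  (\sum_(k <- finsupp m) m k)%N.

Notation multi_index_of n := {m : multi_index | mi_sum m == n}.

Definition mi_add (m m' : multi_index) : multi_index :=
  [fsfun k in (finsupp m `|` finsupp m')%fset => (m k + m' k)%N].

Definition mi_le (m m' : multi_index) := forall k, (m k <= m' k)%N.

Definition mi_supp (m : multi_index) : seq nat := sort leq (finsupp m).

(* the entries of x_0^(m_0) (x) x_1^(m_1) (x) ... *)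
Definition mi_seq {V : Type} (x : nat -> V) (m : multi_index) : seq V :=
  flatten [seq nseq (m k) (x k) | k <- mi_supp m].

Section hermite.
Context {R : realType}.

Definition is_hermite (h : nat -> R -> R) := forall t x : R,
  series (fun n => t ^+ n / n`!%:R * h n x) @ \oo --> expR (t * x - t ^+ 2 / 2).

(* The exponent is real. *)
Definition is_complex_hermite (J : nat -> nat -> R[i] -> R[i]) :=
  forall l z : R[i],
  partial_sum (fun pq : nat * nat =>
    l^* ^+ pq.1 * l ^+ pq.2 / (pq.1`!%:R * pq.2`!%:R) * J pq.1 pq.2 z : R[i]^o)
    @ totally -->
  ((expR (Re (l * z^* + l^* * z - 2 * `|l| ^+ 2)))%:C : R[i]^o).

End hermite.

Section probability.
Context {R : realType} {d : measure_display} {Omega : measurableType d}.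
Variable P : probability Omega R.

Local Notation L2 := (Lfun P 2%:E).

Definition L2norm (F : Omega -> R) : \bar R := ('N[P]_2%:E[EFin \o F])%E.

(* [normal_prob 0 0] is not the Dirac measure. *)
Definition centered_gaussian (F : Omega -> R) :=
  {ae P, forall w, F w = 0} \/
  exists2 s : R, 0 < s &
    forall A, measurable A -> P (F @^-1` A) = normal_prob 0 s A.

Definition isonormal (H : realHilbertType R) (X : H -> {RV P >-> R}) :=
  (forall n (a : 'I_n -> R) (h : 'I_n -> H),
    centered_gaussian (fun w => \sum_(i < n) a i * X (h i) w)) /\
  (forall h g, 'E_P[(X h \* X g)%R] = (inner h g)%:E)%E.

Definition sigma_of (T : Type) (X : T -> {RV P >-> R}) : set (set Omega) :=
  <<s [set A | exists t (B : set R), measurable B /\ A = X t @^-1` B] >>.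

Definition independent_families (T U : Type) (X : T -> {RV P >-> R})
    (Y : U -> {RV P >-> R}) :=
  forall A B, sigma_of X A -> sigma_of Y B -> (P (A `&` B) = P A * P B)%E.

Definition L2_sum (I : choiceType) (F : I -> Omega -> R) (G : Omega -> R) :=
  [/\ forall i, F i \in L2, G \in L2 &
      (fun A => L2norm (partial_sum F A \- G)) @ totally --> 0%E].

Section real_integral.
Context {H : realHilbertType R}.
Variables (W : H -> Omega -> R) (hermite : nat -> R -> R) (n : nat).

Definition wiener_chaos : set (Omega -> R) :=
  [set F | F \in L2 /\ forall eps : R, 0 < eps ->
    exists2 G, lspan [set hermite n \o W h | h in [set h : H | `|h| = 1]] G &
      (L2norm (F \- G)%R < eps%:E)%E].

(* The integral does not depend on the complete orthonormal system: the
   defining formula holds for each of them. *)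
Definition is_wiener_ito (T : tensor_power H n) (I : T -> Omega -> R) :=
  [/\ forall a s t, sym_power T s -> sym_power T t ->
        {ae P, forall w, I (a *: s + t) w = a * I s w + I t w},
      forall t, sym_power T t ->
        ('E_P[(fun w => I t w ^+ 2)%R] = (n`!%:R * `|t| ^+ 2)%:E)%E,
      forall t, sym_power T t -> wiener_chaos (I t),
      forall F, wiener_chaos F ->
        exists2 t, sym_power T t & {ae P, forall w, I t w = F w} &
      forall (x : nat -> H) (m : multi_index_of n), complete_orthonormal x ->
        {ae P, forall w, I (symm_seq T (mi_seq x (val m))) w =
          \prod_(k <- finsupp (val m)) hermite (val m k) (W (x k) w)}].

End real_integral.

Section complex_integral.
Context {H : realHilbertType R}.
Variables (Z : cplx H -> Omega -> R[i]) (J : nat -> nat -> R[i] -> R[i]).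
Variables (p q : nat) (Tp : tensor_power (cplx H) p).
Variables (Tq : tensor_power (cplx H) q) (S : tensor_product Tp Tq).

Definition is_complex_wiener_ito (I : S -> Omega -> R[i]) :=
  [/\ forall t, sym_power2 S t ->
        (fun w => Re (I t w)) \in L2 /\ (fun w => Im (I t w)) \in L2,
      forall a s t, sym_power2 S s -> sym_power2 S t ->
        {ae P, forall w, I (a *: s + t) w = a * I s w + I t w},
      forall t, sym_power2 S t ->
        ('E_P[(fun w => Re (`|I t w| ^+ 2))%R] =
         (p`!%:R * q`!%:R * Re (`|t| ^+ 2))%:E)%E &
      forall (x : nat -> cplx H) (mp : multi_index_of p) (mq : multi_index_of q),
        complete_orthonormal x ->
        {ae P, forall w,
          I (tprod (symm_seq Tp (mi_seq x (val mp)))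
                   (symm_seq Tq (mi_seq (cplx_conj \o x) (val mq)))) w =
          \prod_(k <- finsupp (mi_add (val mp) (val mq)))
            ((Num.sqrt 2 ^- (val mp k + val mq k))%:C *
             J (val mp k) (val mq k) ((Num.sqrt 2)%:C * Z (x k) w))}].

End complex_integral.

Section processes.
Context {H : realHilbertType R}.
Variables X Y : H -> {RV P >-> R}.

Definition process_sum (h : dsum H H) (w : Omega) : R := X h.1 w + Y h.2 w.

Definition complex_process (h : cplx H) (w : Omega) : R[i] :=
  ((X h.1 w +i* X h.2 w) + 'i * (Y h.1 w +i* Y h.2 w)) / (Num.sqrt 2)%:C.

End processes.

End probability.

Section kernels.
Context {R : realType} {H : realHilbertType R}.
Variable e : nat -> cplx H.

Definition u10 (k : nat) : dsum H H :=
  (Num.sqrt 2)^-1 *: (((e k).1, - (e k).2) : dsum H H).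

Definition v10 (k : nat) : dsum H H :=
  (Num.sqrt 2)^-1 *: (((e k).2, (e k).1) : dsum H H).

(* the coefficient a_{k,j}, with a = p_k and b = q_k *)
Definition acoef (a b j : nat) : R[i] :=
  'i ^+ (a + b - j) *
  \sum_(r < j.+1) \sum_(s < j.+1 | (r + s == j)%N)
    'C(a, r)%:R * 'C(b, s)%:R * (-1) ^+ (b - s).

(* For j <= mp + mq, the factors outside this range are equal to 1. *)
Definition acoef_prod (mp mq j : multi_index) : R[i] :=
  \prod_(l <- finsupp (mi_add mp mq)) acoef (mp l) (mq l) (j l).

(* the entries of
   u_0^(j_0) (x) v_0^(mp_0 + mq_0 - j_0) (x) u_1^(j_1) (x) ... *)
Definition uv_seq (mp mq j : multi_index) : seq (dsum H H) :=
  flatten [seq nseq (j k) (u10 k) ++ nseq (mp k + mq k - j k) (v10 k)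
          | k <- mi_supp (mi_add mp mq)].

Context {n : nat}.
Variables (T : tensor_power (dsum H H) n) (mp mq : multi_index).

(* Both sums range over a finite set. *)
Definition ukernel : T :=
  \sum_(j \in [set j | mi_le j (mi_add mp mq)])
    Re (acoef_prod mp mq j) *: symm_seq T (uv_seq mp mq j).

Definition vkernel : T :=
  \sum_(j \in [set j | mi_le j (mi_add mp mq)])
    Im (acoef_prod mp mq j) *: symm_seq T (uv_seq mp mq j).

End kernels.

(* Main.v *)
Require Import Defs.
From mathcomp Require Import all_boot all_order all_algebra finmap perm complex.
From mathcomp Require Import all_classical all_reals all_analysis.
From mathcomp Require Import showcase.summability measurable_realfun.
From mathcomp Require Import ring lra zify.

(* Every Z(e_k) equals W(u_k) + i W(v_k), and the u_k and v_k together form a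
   complete orthonormal system of the direct sum. Comparing generating functions,
   J_{p,q}(x + i y) = sum_j a_j H_j(x) H_{p+q-j}(y), so that on a basis tensor the
   complex integral is I(u(p,q)) + i I(v(p,q)) almost surely. If I_{p,q}(t) equals
   I(s) + i I(s'), the two isometries give n! (|s|^2 + |s'|^2) = p! q! |t|^2 with
   n = p + q: the partial sums of both real kernels are therefore Cauchy, and the
   representation passes to their limits. Uniqueness is the injectivity of the
   isometry I. *)

Set Implicit Arguments.
Unset Strict Implicit.
Unset Printing Implicit Defensive.

Import Order.TTheory GRing.Theory Num.Theory.
Import numFieldNormedType.Exports.

Local Open Scope classical_set_scope.
Local Open Scope ring_scope.
Local Open Scope complex_scope.

Local Notation Re := complex.Re.
Local Notation Im := complex.Im.
Local Notation "x ^*" := (Num.conj x) : complex_scope.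

(** * Power series *)

(** The polynomials [hermite] and [J] are known only through their generating series, so identities
    between them have to come from comparing coefficients. The series of [J] is a double one, in [l]
    and its conjugate. It is restricted to the lines l = r (1 + i t) with t fixed: there it becomes
    a power series in the real variable r, and the exponential factors into two real generating
    functions. The coefficient of r^n still mixes all [J p q] with p + q = n; varying t separates
    them. Convergence of the two real series cannot in general be read off the coefficients c by
    orthogonality. Exchanging the two multi-indices conjugates the [acoef], so that when p = q
    distinct pairs may have the same u and opposite v. The relation [represents] therefore keeps
    both real kernels together with the complex tensor, and only the joint norm of the two kernels
    is compared with the norm of the tensor. *)

Section power_series.
Context {R : realType}.
Implicit Types a b : nat -> R.

Lemma pseries_bound a (x : R) :
  cvgn (pseries a x) -> exists2 M, 0 < M & forall n, `|a n * x ^+ n| <= M.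
Proof.
move=> /cvg_series_cvg_0 /cvgP /cvg_seq_bounded /pinfty_ex_gt0[M M0 h].
by exists M => // n; exact: h.
Qed.

(** If the earlier coefficients vanish, the term of order n has to be compensated by the tail. The
    coefficients are bounded, by convergence at 1, so the tail is O(x^(n+1)); dividing by x^n and
    taking x small forces a_n = 0. *)
Lemma pseries_eq0 a :
  (forall x, pseries a x @ \oo --> (0 : R)) -> forall n, a n = 0.
Proof.
move=> a0; elim/ltn_ind => n IH.
have [|M M0 aM] := @pseries_bound a 1; first by apply/cvgP/a0.
have aM1 k : `|a k| <= M by have := aM k; rewrite expr1n mulr1.
suff h (x : R) : 0 < x -> x <= 2^-1 -> `|a n| <= 2 * M * x.
  apply/eqP/contraT; rewrite -normr_gt0 => an0.
  (* For this x the bound 2 M x is at most |a_n| / 2, which contradicts a_n != 0. *)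
  pose x := Num.min (2^-1) (`|a n| / (4 * M)).
  have x0 : 0 < x by rewrite lt_min invr_gt0 ltr0n/= divr_gt0// mulr_gt0.
  have := h x x0; rewrite ge_min lexx => /(_ isT).
  have : x <= `|a n| / (4 * M) by rewrite ge_min lexx orbT.
  rewrite ler_pdivlMr ?mulr_gt0// => h1 h2.
  nra.
move=> x0 x2.
rewrite -(ler_pM2r (exprn_gt0 n x0)).
have := a0 x => /cvg_norm; rewrite normr0 => cv.
have geo N : \sum_(n.+1 <= k < N) `|a k * x ^+ k| <= 2 * M * x * x ^+ n *+ (N > n).
  have [Nn|nN] := leqP N n; first by rewrite big_geq ?mulr0n ?(leq_trans Nn).
  rewrite mulr1n.
  have -> : 2 * M * x * x ^+ n = 2 * M * x ^+ n.+1 by rewrite exprS; ring.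
  (* The subtracted term makes the induction on N go through: x <= 1/2 gives x^N <= 2 x^N - 2
     x^(N+1). *)
  have : \sum_(n.+1 <= k < N) `|a k * x ^+ k| <= 2 * M * x ^+ n.+1 - 2 * M * x ^+ N.
    elim: N nN => // N IHN; rewrite ltnS leq_eqVlt => /predU1P[<-|nN].
      by rewrite big_geq// subrr.
    rewrite big_nat_recr//=; have := IHN nN; have := aM1 N.
    rewrite normrM normrX (gtr0_norm x0) (exprS x N).
    have xN := exprn_gt0 N x0.
    move=> /(ler_wpM2r (ltW xN)) h1 h2.
    have := ler_wpM2l (ltW (mulr_gt0 M0 xN)) x2.
    nra.
  have := exprn_gt0 N x0; nra.
suff : `|a n| * x ^+ n - 2 * M * x * x ^+ n <= 0 by lra.
apply: (cvgr_to_ge cv) => //; near=> N.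
have nN : (n < N)%N by near: N; exists n.+1.
rewrite /pseries /series/= (big_cat_nat (n := n.+1))//=.
rewrite big_nat_recr//= big_nat big1 ?add0r; last first.
  by move=> i /= iN; rewrite IH ?mul0r.
have := geo N; rewrite nN mulr1n => gN.
have := le_trans (ler_norm_sum _ _ _) gN => {}gN.
have := lerB_normD (a n * x ^+ n) (\sum_(n.+1 <= i < N) a i * x ^+ i).
rewrite normrM normrX (gtr0_norm x0).
lra.
Unshelve. all: by end_near. Qed.

Lemma pseries_inj a b :
  (forall x, exists l : R, pseries a x @ \oo --> l /\ pseries b x @ \oo --> l) ->
  forall n, a n = b n.
Proof.
move=> ab n; apply/eqP; rewrite -subr_eq0; apply/eqP.
apply: (@pseries_eq0 (fun n => a n - b n)) => x.
have [l [al bl]] := ab x.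
rewrite -(subrr l) (_ : pseries _ x = pseries a x \- pseries b x); first exact: cvgB.
apply/funext => N; rewrite /pseries /series/= -sumrB.
by apply: eq_bigr => i _; rewrite mulrBl.
Qed.

(* The terms at [x] are O(8^-n) because the series converge at [8 x], so the at
   most [N ^ 2] products outside of the triangle sum up to O(2^-N). *)
Lemma pseries_mul a b (x la lb : R) :
  (forall x, cvgn (pseries a x)) -> (forall x, cvgn (pseries b x)) ->
  pseries a x @ \oo --> la -> pseries b x @ \oo --> lb ->
  pseries (fun n => \sum_(j < n.+1) a j * b (n - j)%N) x @ \oo --> la * lb.
Proof.
move=> ca cb al bl.
suff h : (pseries a x \* pseries b x) \-
    pseries (fun n => \sum_(j < n.+1) a j * b (n - j)%N) x @ \oo --> (0 : R).
  have := cvgB (cvgM al bl) h; rewrite subr0.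
  set g := (X in X @ _ --> _); move=> gl.
  suff -> : pseries (fun n => \sum_(j < n.+1) a j * b (n - j)%N) x = g by exact: gl.
  by apply/funext => n; rewrite /g fctE /= opprB addrC subrK.
have bound c : (forall x, cvgn (pseries c x)) ->
    exists2 M, 0 < M & forall n, `|c n * x ^+ n| <= M * 8^-1 ^+ n.
  move=> cc; have [M M0 h] := pseries_bound (cc (8 * x)).
  exists M => // n; have := h n.
  rewrite exprMn mulrCA normrM (gtr0_norm (exprn_gt0 n _))// exprVn.
  by rewrite ler_pdivlMr ?exprn_gt0// mulrC.
have [A A0 hA] := bound _ ca.
have [B B0 hB] := bound _ cb.
pose F (i j : nat) := (a i * x ^+ i) * (b j * x ^+ j).
(* Only the products F i k with i + k < N occur. Listing them by rows instead of by total degree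
   allows a row by row comparison with the full square. *)
have diag N : pseries (fun n => \sum_(j < n.+1) a j * b (n - j)%N) x N =
    \sum_(0 <= i < N) \sum_(0 <= k < N - i) F i k.
  rewrite /pseries /series/=.
  transitivity (\sum_(0 <= n < N) \sum_(0 <= j < N | (j <= n)%N) F j (n - j)%N).
    apply: eq_big_nat => n /= nN.
    rewrite mulr_suml -(big_mkord xpredT (fun j => a j * b (n - j)%N * x ^+ n)).
    rewrite (big_nat_widen _ _ N)//; apply: eq_bigr => j; rewrite ltnS => jn.
    by rewrite /F -{2}(subnKC jn) exprD; ring.
  rewrite (exchange_big_dep_nat xpredT)//=.
  apply: eq_big_nat => j /= jN.
  transitivity (\sum_(j <= n < N) F j (n - j)%N).
    by rewrite big_mkord big_geq_mkord.
  rewrite -{1}(add0n j) big_addn.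
  by apply: eq_bigr => k _; rewrite addnK.
have err N : `|(pseries a x \* pseries b x) N -
    pseries (fun n => \sum_(j < n.+1) a j * b (n - j)%N) x N| <=
    A * B * 2^-1 ^+ N.
  rewrite diag /pseries /series/= mulr_suml -sumrB.
  have step i : (i < N)%N -> `|a i * x ^+ i * (\sum_(0 <= j < N) b j * x ^+ j) -
      \sum_(0 <= k < N - i) F i k| <= A * B * 8^-1 ^+ N *+ N.
    move=> iN; rewrite mulr_sumr (big_cat_nat (n := (N - i)%N))//= ?leq_subr//.
    set s1 := \sum_(0 <= k < N - i) F i k; set s2 := \sum_(_ <= _ < _) _.
    rewrite (_ : _ - _ = s2); last by rewrite /s1; ring.
    rewrite (le_trans (ler_norm_sum _ _ _))//.
    apply: (@le_trans _ _ (\sum_(N - i <= k < N) A * B * 8^-1 ^+ N)).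
      apply: ler_sum_nat => k /andP[Nk kN].
      rewrite normrM (le_trans (ler_pM _ _ (hA i) (hB k)))//.
      rewrite mulrACA ler_pM2l ?mulr_gt0// -exprD.
      by rewrite ler_wiXn2l ?invr_ge0 ?ler0n ?invf_le1 ?ler1n// -leq_subLR.
    rewrite sumr_const_nat ler_wpMn2l ?mulr_ge0 ?exprn_ge0 ?(ltW A0) ?(ltW B0)//.
    by rewrite leq_subr.
  rewrite (le_trans (ler_norm_sum _ _ _))//.
  apply: (@le_trans _ _ (\sum_(0 <= k < N) A * B * 8^-1 ^+ N *+ N)).
    by apply: ler_sum_nat => k /andP[_]; exact: step.
  rewrite sumr_const_nat subn0 -mulrnA -(mulr_natr (A * B * _)) natrM.
  rewrite -!mulrA ler_pM2l// ler_pM2l//.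
  (* The choice of 8: N^2 <= 4^N, so that N^2 8^-N <= 2^-N, which tends to 0. *)
  have N2 : N%:R <= 2 ^+ N :> R by rewrite -natrX ler_nat; exact/ltnW/ltn_expl.
  have -> : (2^-1 : R) ^+ N = 8^-1 ^+ N * (2 ^+ N * 2 ^+ N).
    by rewrite -!exprMn; congr (_ ^+ _); field.
  rewrite ler_pM2l ?exprn_gt0// ler_pM//.
have geo : (fun N => A * B * 2^-1 ^+ N) @ \oo --> (0 : R).
  rewrite -(mulr0 (A * B)); apply: cvgMr; apply: cvg_expr.
  by rewrite gtr0_norm// invf_lt1 ?ltr1n.
apply: (@squeeze_cvgr _ _ _ _ (fun N => - (A * B * 2^-1 ^+ N))
  (fun N => A * B * 2^-1 ^+ N)).
- by near=> N; rewrite -ler_norml; exact: err.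
- by rewrite -oppr0; exact: cvgN.
- exact: geo.
Unshelve. all: by end_near. Qed.
End power_series.

(** * Complex Hermite polynomials *)

Section acoef.
Context {R : realType}.
Implicit Types m : R[i].

Lemma coef_XaddC_exp (A : comNzRingType) (c : A) n j :
  (('X + c%:P) ^+ n)`_j = c ^+ (n - j) * 'C(n, j)%:R.
Proof.
rewrite addrC exprDn coef_sum.
under eq_bigr do
  rewrite -polyC_exp coefMn mul_polyC coefZ coefXn -(mulr_natr (_ * _)).
have [jn|nj] := ltnP j n.+1; last first.
  rewrite bin_small// mulr0 big1// => i _.
  case: eqVneq => [ji|_]; last by rewrite mulr0n mulr0 mul0r.
  by move: nj; rewrite ji leqNgt ltn_ord.
rewrite (bigD1 (Ordinal jn))//= eqxx mulr1 big1 ?addr0// => i ij.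
case: eqVneq => //; last by rewrite mulr0n mulr0 mul0r.
by move=> ji; move: ij; rewrite -val_eqE/= ji eqxx.
Qed.

(** The defining double sum is the convolution of two binomial expansions; their constants i^(a-r)
    and (-i)^(b-s) combine into i^(a+b-j) (-1)^(b-s). Sums involving [acoef] thereby become
    expansions of powers of polynomials. *)
Lemma acoefE a b j :
  acoef a b j = (('X + 'i%:P) ^+ a * ('X + (- 'i)%:P) ^+ b)`_j :> R[i].
Proof.
rewrite coefM /acoef mulr_sumr; apply: eq_bigr => r _.
have rj : (j - r < j.+1)%N by rewrite ltnS leq_subr.
rewrite (big_pred1 (Ordinal rj)) => [|s]; last first.
  by rewrite /= -val_eqE/=; have := ltn_ord r; lia.
rewrite /= !coef_XaddC_exp.
(* The exponent a + b - j splits only when r <= a and j - r <= b, the subtraction being truncated;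
   otherwise a binomial coefficient vanishes on both sides. *)
have [ra|ar] := leqP r a; last by rewrite (bin_small ar) mulr0 !mul0r mulr0.
have [sb|bs] := leqP (j - r) b; last by rewrite (bin_small bs) !mulr0 mul0r mulr0.
have -> : (a + b - j = (a - r) + (b - (j - r)))%N by have := ltn_ord r; lia.
rewrite exprD (exprNn 'i).
ring.
Qed.

(* Two expansions of the coefficient of X^j in (mc (X + i) + m (X - i))^n. *)
Lemma acoef_gen m mc n j :
  \sum_(q < n.+1)
    (mc ^+ (n - q) * m ^+ q / ((n - q)`!%:R * q`!%:R)) * acoef (n - q) q j =
  (if (j <= n)%N then
     (m + mc) ^+ j * ('i * (mc - m)) ^+ (n - j) / (j`!%:R * (n - j)`!%:R) else 0).
Proof.
have nf k : (k`!%:R : R[i]) != 0 by rewrite pnatr_eq0 -lt0n fact_gt0.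
have binE k : (k <= n)%N ->
    ((n - k)`!%:R * k`!%:R)^-1 = n`!%:R^-1 * 'C(n, k)%:R :> R[i].
  move=> kn; rewrite -(bin_fact kn) !natrM !invfM mulrC [RHS]mulrC mulVKf//.
  by rewrite pnatr_eq0 -lt0n bin_gt0.
pose P : {poly R[i]} := (mc *: ('X + 'i%:P) + m *: ('X + (- 'i)%:P)) ^+ n.
have PE : P = ((m + mc) *: 'X + ('i * (mc - m))%:P) ^+ n.
  congr (_ ^+ _); rewrite !scalerDr -!mul_polyC !polyCN !polyCM !rmorphD/= polyCN.
  by ring.
transitivity (n`!%:R^-1 * P`_j).
  rewrite /P exprDn coef_sum mulr_sumr; apply: eq_bigr => q _.
  have qn : (q <= n)%N by rewrite -ltnS.
  rewrite binE// acoefE [in RHS]exprZn [in RHS]exprZn.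
  rewrite -[in RHS]scalerAl -[in RHS]scalerAr scalerA coefMn coefZ.
  by rewrite -[in RHS](mulr_natr (_ * _)); ring.
rewrite PE; case: leqP => jn; last first.
  rewrite nth_default ?mulr0// (leq_trans _ jn)//.
  rewrite (leq_trans (size_poly_exp_leq _ _))// ltnS.
  rewrite -[leqRHS]mul1n leq_mul2r; apply/orP; right.
  rewrite -subn1 leq_subLR (leq_trans (size_polyD _ _))// geq_max.
  rewrite (leq_trans (size_scale_leq _ _)) ?size_polyX//.
  by rewrite (leq_trans (size_polyC_leq1 _)).
rewrite [X in _ / X]mulrC binE// addrC exprDn coef_sum (bigD1 (inord j))//= inordK//.
rewrite big1 => [|i ij].
  rewrite addr0 coefMn exprZn -polyC_exp mul_polyC !coefZ coefXn eqxx mulr1.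
  by rewrite -[in LHS](mulr_natr (_ * _)); ring.
rewrite coefMn exprZn -polyC_exp mul_polyC !coefZ coefXn; case: eqVneq => ji.
  by move: ij; rewrite ji inord_val eqxx.
by rewrite !mulr0 mul0rn.
Qed.

End acoef.

Section complex_parts.
Context {R : realType}.
Implicit Types x y : R[i].

Lemma cReD x y : Re (x + y) = Re x + Re y. Proof. by case: x; case: y. Qed.
Lemma cImD x y : Im (x + y) = Im x + Im y. Proof. by case: x; case: y. Qed.
Lemma cReB x y : Re (x - y) = Re x - Re y. Proof. by case: x; case: y. Qed.
Lemma cImB x y : Im (x - y) = Im x - Im y. Proof. by case: x; case: y. Qed.

Lemma cReM x y : Re (x * y) = Re x * Re y - Im x * Im y.
Proof. by case: x; case: y. Qed.
Lemma cImM x y : Im (x * y) = Re x * Im y + Im x * Re y.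
Proof. by case: x; case: y. Qed.

Lemma Re_sum I (r : seq I) (P : pred I) (F : I -> R[i]) :
  Re (\sum_(i <- r | P i) F i) = \sum_(i <- r | P i) Re (F i).
Proof. exact: (big_morph _ cReD). Qed.

Lemma Im_sum I (r : seq I) (P : pred I) (F : I -> R[i]) :
  Im (\sum_(i <- r | P i) F i) = \sum_(i <- r | P i) Im (F i).
Proof. exact: (big_morph _ cImD). Qed.

Lemma complex_eqP x y : Re x = Re y -> Im x = Im y -> x = y.
Proof. by case: x; case: y => a b c d /= -> ->. Qed.

Lemma conjcE (a b : R) : (a +i* b)^* = a +i* (- b) :> R[i]. Proof. by []. Qed.

Lemma normc_ge_Im x : `|Im x|%:C <= `|x|.
Proof. by rewrite normc_def lecR -sqrtr_sqr ler_wsqrtr// lerDr sqr_ge0. Qed.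

Lemma sqr_normcE x : Re (`|x| ^+ 2) = Re x ^+ 2 + Im x ^+ 2.
Proof. by rewrite -add_Re2_Im2. Qed.

End complex_parts.

Section triangle.
Local Open Scope fset_scope.

(** Finite sets exhausting the pairs by total degree: summing along them groups a double series into
    its homogeneous parts. *)
Definition triangle (N : nat) : {fset nat * nat} :=
  [fset x in [seq ((n - q)%N, q) | n <- iota 0 N, q <- iota 0 n.+1]].

Lemma mem_triangle N p q : ((p, q) \in triangle N) = (p + q < N)%N.
Proof.
rewrite inE; apply/allpairsPdep/idP => [[n [q' []]]|pqN].
  by rewrite !mem_iota => /= nN qn [-> ->]; lia.
exists (p + q)%N, q; split; rewrite ?mem_iota//=; first by lia.
by rewrite addnK.
Qed.

Lemma big_triangle (V : nmodType) (F : nat * nat -> V) N :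
  \sum_(x <- triangle N) F x = \sum_(n < N) \sum_(q < n.+1) F ((n - q)%N, val q).
Proof.
have u : uniq [seq ((n - q)%N, q) | n <- iota 0 N, q <- iota 0 n.+1].
  apply: allpairs_uniq_dep => [|n _|]; [exact: iota_uniq|exact: iota_uniq|].
  move=> [n q] [n' q'] /allpairsPdep[a [b []]] + + [-> ->].
  move=> + + /allpairsPdep[a' [b' []]] + + [-> ->].
  rewrite !mem_iota => aN ba aN' ba' [+ E]; rewrite -E => ab.
  by have -> : a = a' by lia.
have pe : perm_eq (triangle N)
    [seq ((n - q)%N, q) | n <- iota 0 N, q <- iota 0 n.+1].
  by apply: (uniq_perm (fset_uniq _) u) => x; rewrite inE.
rewrite (perm_big _ pe).
rewrite big_allpairs_dep.
rewrite -[in LHS](subn0 N) -/(index_iota 0 N) big_mkord; apply: eq_bigr => n _.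
by rewrite -[n.+1]subn0 -/(index_iota 0 n.+1) big_mkord subn0.
Qed.

(** A finite set of pairs lies in [triangle N] as soon as N exceeds the sum of all its coordinates.
    An unconditional limit is thus also the limit along the triangles. *)
Lemma triangle_totally : triangle @ \oo `=>` totally.
Proof.
move=> A [B _ BA]; suff : \forall N \near \oo, A (triangle N) by [].
near=> N; apply: BA => /=; apply/fsubsetP => -[p q] pqB.
rewrite mem_triangle.
apply: (@leq_ltn_trans (\sum_(x <- B) (x.1 + x.2))%N); last first.
  by near: N; exists (\sum_(x <- B) (x.1 + x.2)).+1%N.
by rewrite (big_fsetD1 (p, q))//= leq_addr.
Unshelve. all: by end_near. Qed.

End triangle.

Lemma partial_sumE (I : choiceType) (V : zmodType) (x : I -> V) (A : {fset I}) :
  partial_sum x A = \sum_(i <- A) x i.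
Proof. by rewrite /partial_sum big_seq_fsetE. Qed.

Section complex_hermite.
Context {R : realType}.
Variables (hermite : nat -> R -> R) (J : nat -> nat -> R[i] -> R[i]).
Hypothesis hermiteP : is_hermite hermite.
Hypothesis JP : is_complex_hermite J.

(** At t = 0 only the first term of the generating series survives, as 0^0 = 1. This value makes
    factors of exponent 0 disappear from the products over multi-indices. *)
Lemma hermite0 x : hermite 0 x = 1.
Proof.
have := @hermiteP 0 x.
rewrite mul0r expr0n/= mul0r subr0 expR0 => h.
have h' : series (fun n : nat => (0 : R) ^+ n / n`!%:R * hermite n x) @ \oo -->
    hermite 0 x.
  apply: cvg_near_cst; near=> n.
  rewrite /series/= (_ : n = n.-1.+1); last by rewrite prednK//; near: n; exists 1%N.
  rewrite big_nat_recl//= expr0 fact0 divr1 mul1r big1 ?addr0// => i _.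
  by rewrite expr0n/= !mul0r.
by rewrite -(cvg_lim _ h)// (cvg_lim _ h').
Unshelve. all: by end_near. Qed.

(** The factor k lets the real series at 2 r and at 2 t r be multiplied as power series in the same
    variable r. *)
Lemma hermite_pseries k x (r : R) :
  pseries (fun n => k ^+ n / n`!%:R * hermite n x) r @ \oo -->
  expR (k * r * x - (k * r) ^+ 2 / 2).
Proof.
have := @hermiteP (k * r) x; apply: cvg_trans; apply: near_eq_cvg.
near=> N; apply: eq_bigr => n _; rewrite /= exprMn. ring.
Unshelve. all: by end_near. Qed.

(* The generating function of J along the line l = r (1 + i t), as a power series
   in the real variable r. *)
Lemma complex_hermite_pseries x y (t r : R) :
  let m : R[i] := 1 +i* t in
  let D n := \sum_(q < n.+1)
    (m^* ^+ (n - q) * m ^+ q / ((n - q)`!%:R * q`!%:R)) * J (n - q) q (x +i* y) in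
  pseries (fun n => Re (D n)) r @ \oo -->
    expR (2 * r * x - (2 * r) ^+ 2 / 2 + (2 * t * r * y - (2 * t * r) ^+ 2 / 2)) /\
  pseries (fun n => Im (D n)) r @ \oo --> (0 : R).
Proof.
move=> m D.
set E := expR _.
have h : forall eps : R, 0 < eps -> \forall N \near \oo,
    `|E%:C - \sum_(0 <= n < N) D n * r%:C ^+ n| < eps%:C.
  move=> eps eps0.
  have := @JP (r%:C * m) (x +i* y).
  rewrite -add_Re2_Im2 => /cvgrPdist_lt /(_ eps%:C).
  rewrite ltcR => /(_ totally_filter eps0) /triangle_totally h.
  apply: (@filterS _ \oo _ (triangle @^-1` _) _ _ h) => N /=.
  congr (`|_ - _| < _).
    (* With z = x + i y the exponent is 2 r x - 2 r^2 + 2 t r y - 2 t^2 r^2: the sum of the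
       exponents of two real Hermite series, at 2 r and at 2 t r. *)
    congr (expR _)%:C.
    field.
    by [].
  rewrite partial_sumE big_triangle big_mkord; apply: eq_bigr => n _.
  rewrite mulr_suml; apply: eq_bigr => q _ /=.
  have -> : (r%:C * m)^* = r%:C * m^* by rewrite rmorphM/= conjcE oppr0.
  rewrite !exprMn -[in r%:C ^+ n](subnK (_ : q <= n)%N) 1?exprD; first by ring.
  by rewrite -ltnS.
split; apply/cvgrPdist_lt => eps /h; apply: filterS => N.
  rewrite -ltcR; apply: le_lt_trans.
  rewrite (le_trans _ (normc_ge_Re _))// lecR cReB Re_sum le_eqVlt.
  apply/orP; left.
  apply/eqP; congr (`|_ - _|); apply: eq_bigr => i _.
  by rewrite -rmorphXn/= cReM/= mulr0 subr0.
rewrite -ltcR; apply: le_lt_trans.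
rewrite (le_trans _ (normc_ge_Im _))// lecR cImB Im_sum le_eqVlt.
apply/orP; left.
apply/eqP; congr (`|_ - _|); apply: eq_bigr => i _.
by rewrite -rmorphXn/= cImM/= mulr0 add0r.
Qed.

(** Both sides are the coefficient of r^n in one power series: the right one is the Cauchy product
    of the two real Hermite series, and the imaginary parts sum to 0. *)
Lemma complex_hermite_diagonal x y (t : R) n :
  let m : R[i] := 1 +i* t in
  \sum_(q < n.+1)
    (m^* ^+ (n - q) * m ^+ q / ((n - q)`!%:R * q`!%:R)) * J (n - q) q (x +i* y) =
  (\sum_(j < n.+1) (2 ^+ j / j`!%:R * hermite j x) *
     ((2 * t) ^+ (n - j) / (n - j)`!%:R * hermite (n - j) y))%:C.
Proof.
move=> m; pose D n := \sum_(q < n.+1)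
    (m^* ^+ (n - q) * m ^+ q / ((n - q)`!%:R * q`!%:R)) * J (n - q) q (x +i* y).
pose E n := \sum_(j < n.+1) (2 ^+ j / j`!%:R * hermite j x) *
     ((2 * t) ^+ (n - j) / (n - j)`!%:R * hermite (n - j) y).
have h1 k z r : cvgn (pseries (fun n => k ^+ n / n`!%:R * hermite n z) r).
  by apply/cvgP/hermite_pseries.
apply: complex_eqP => /=.
  apply: (@pseries_inj _ (fun n => Re (D n)) E) => r.
  have [h _] := complex_hermite_pseries x y t r.
  eexists; split; first exact: h.
  rewrite expRD.
  exact: (pseries_mul (h1 2 x) (h1 (2 * t) y) (@hermite_pseries 2 x r)
    (@hermite_pseries (2 * t) y r)).
apply: (@pseries_eq0 _ (fun n => Im (D n))) => r.
by have [_ h] := complex_hermite_pseries x y t r.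
Qed.

Lemma complex_hermiteE p q x y :
  J p q (x +i* y) =
  \sum_(j < (p + q).+1) acoef p q j * (hermite j x * hermite (p + q - j) y)%:C.
Proof.
pose J' p q : R[i] := \sum_(j < (p + q).+1)
  acoef p q j * (hermite j x * hermite (p + q - j) y)%:C.
set n := (p + q)%N.
pose K k := (J (n - k) k (x +i* y) - J' (n - k)%N k) / ((n - k)`!%:R * k`!%:R).
have Kt (t : R) : let m : R[i] := 1 +i* t in
    \sum_(k < n.+1) K k * (m / m^*) ^+ k = 0.
  move=> m.
  have m0 : m^* != 0 by rewrite conjC_eq0 eq_complex/= oner_eq0.
  apply: (mulfI (expf_neq0 n m0)); rewrite mulr0 mulr_sumr.
  transitivity (\sum_(k < n.+1)
      (m^* ^+ (n - k) * m ^+ k / ((n - k)`!%:R * k`!%:R)) *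
      J (n - k) k (x +i* y) - \sum_(k < n.+1)
      (m^* ^+ (n - k) * m ^+ k / ((n - k)`!%:R * k`!%:R)) * J' (n - k)%N k).
    rewrite -sumrB; apply: eq_bigr => k _; rewrite -mulrBr /K expr_div_n.
    have kn : (k <= n)%N by rewrite -ltnS.
    rewrite -[in m^* ^+ n](subnK kn) exprD.
    have := expf_neq0 k m0; set a := m^* ^+ k => a0; set b := m^* ^+ _.
    set f := _%:R * _%:R; set jj := _ - _.
    by transitivity (b * m ^+ k / f * jj * (a / a)); [ring|rewrite mulfV// mulr1].
  rewrite complex_hermite_diagonal; apply/eqP; rewrite subr_eq0; apply/eqP.
  have -> : \sum_(k < n.+1)
      (m^* ^+ (n - k) * m ^+ k / ((n - k)`!%:R * k`!%:R)) * J' (n - k)%N k =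
    \sum_(k < n.+1) \sum_(j < n.+1)
      (m^* ^+ (n - k) * m ^+ k / ((n - k)`!%:R * k`!%:R)) * acoef (n - k) k j *
        (hermite j x * hermite (n - j) y)%:C.
    apply: eq_bigr => k _; rewrite /J' subnK -1?ltnS// mulr_sumr.
    by apply: eq_bigr => j _; rewrite mulrA.
  (* Here the factors 2 and 2 t of the real series reappear, as m + m^* and i (m^* - m). *)
  rewrite exchange_big/= rmorph_sum; apply: eq_bigr => j _.
  rewrite -mulr_suml acoef_gen -ltnS ltn_ord.
  have -> : m + m^* = 2%:C by rewrite /m conjcE; simpc; congr (_ +i* _); ring.
  have -> : 'i * (m^* - m) = (2 * t)%:C.
    by rewrite /m conjcE; simpc; congr (_ +i* _); ring.
  rewrite !rmorphM/= !rmorphXn/= !fmorphV/= !rmorph_nat.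
  by rewrite [(2 * t)%:C]rmorphM rmorph_nat invfM; ring.
pose P := \poly_(k < n.+1) K k.
(* These values are pairwise distinct, which makes [P] vanish. *)
pose v (k : nat) : R[i] := (1 +i* k%:R) / (1 +i* k%:R)^*.
have P0 : P = 0.
  apply: (@roots_geq_poly_eq0 _ P [seq v k | k <- iota 0 n.+1]).
  - by apply/allP => _ /mapP[k _ ->]; rewrite /root horner_poly Kt.
  - rewrite map_inj_uniq ?iota_uniq// => j k.
    rewrite /v => /eqP; rewrite eqr_div ?conjC_eq0 ?eq_complex/= ?oner_eq0//.
    move=> /andP[_ /eqP] h.
    have : (j%:R : R) = k%:R by lra.
    by move/eqP; rewrite eqr_nat => /eqP.
  - by rewrite size_map size_iota size_poly.
have : P`_q = 0 by rewrite P0 coef0.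
rewrite coef_poly ltnS leq_addl /K addnK => /eqP.
have f0 k : k`!%:R != 0 :> R[i] by rewrite pnatr_eq0 -lt0n fact_gt0.
rewrite mulf_eq0 invr_eq0 mulf_eq0 !(negPf (f0 _)) !orbF.
by rewrite subr_eq0 => /eqP.
Qed.

End complex_hermite.

(** * Multi-indices *)

Section multi_index.
Implicit Types (m : multi_index) (N : nat).

(** A common bound N replaces the varying supports by the single index type ['I_N], over which
    products of sums can be distributed. *)
Definition mi_bounded N m := forall k, (N <= k)%N -> m k = 0%N.

Lemma mi_bounded_ex m : exists N, mi_bounded N m.
Proof.
exists (\sum_(k <- finsupp m) k.+1)%N => k; apply: contraPeq => mk.
have km : k \in finsupp m by rewrite mem_finsupp.
by apply/negP; rewrite -ltnNge (big_fsetD1 k)//= addSn ltnS leq_addr.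
Qed.

Lemma mi_addE m m' k : mi_add m m' k = (m k + m' k)%N.
Proof.
rewrite fsfunE inE; case: (finsuppP m k) => [_|km]/=; last by [].
by case: (finsuppP m' k).
Qed.

Lemma mi_suppE N m : mi_bounded N m ->
  mi_supp m = [seq k <- iota 0 N | k \in finsupp m].
Proof.
move=> mN; apply: (@irr_sorted_eq _ ltn ltn_trans ltnn).
- rewrite ltn_sorted_uniq_leq sort_uniq fset_uniq/=.
  exact: (sort_sorted leq_total).
- by rewrite sorted_filter ?iota_ltn_sorted//; exact: ltn_trans.
- move=> k; rewrite mem_sort mem_filter mem_iota/= add0n.
  case: (ltnP k N) => [_|/mN km]; first by rewrite andbT.
  by rewrite andbF mem_finsupp km eqxx.
Qed.

Lemma flatten_mi_supp (V : Type) (F : nat -> seq V) N m : mi_bounded N m ->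
  (forall k, m k = 0%N -> F k = [::]) ->
  flatten [seq F k | k <- mi_supp m] = flatten [seq F k | k <- iota 0 N].
Proof.
move=> mN F0; rewrite (mi_suppE mN); elim: (iota 0 N) => //= k s IH.
case: (finsuppP m k) => [km|_]/=; last by rewrite IH.
by rewrite IH F0//; apply/eqP; rewrite -memNfinsupp.
Qed.

Lemma big_finsupp (V : Type) (idx : V) (op : Monoid.com_law idx)
    (F : nat -> V) N m :
  mi_bounded N m -> (forall k, m k = 0%N -> F k = idx) ->
  \big[op/idx]_(k <- finsupp m) F k = \big[op/idx]_(k < N) F k.
Proof.
move=> mN F0; rewrite -(perm_big _ (permEl (perm_sort leq (finsupp m)))).
rewrite -/(mi_supp m) (mi_suppE mN) big_filter -(big_mkord xpredT) /index_iota subn0.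
rewrite big_mkcond; apply: eq_bigr => k _; case: (finsuppP m k) => // km.
by rewrite F0//; apply/eqP; rewrite -memNfinsupp.
Qed.

Section box.
Variables (N : nat) (M : multi_index).
Hypothesis MN : mi_bounded N M.
Let B := (\max_(k < N) M k).+1.

Let MB (k : 'I_N) : (M k < B)%N.
Proof. by rewrite ltnS (leq_bigmax k). Qed.

(** Indices below M are encoded by functions into ['I_B], where B exceeds every value of M: this is
    the finite type required by the distributivity of products over sums. *)
Definition mi_box_of (f : {ffun 'I_N -> 'I_B}) : multi_index :=
  [fsfun k in [fset k in iota 0 N]%fset => oapp (fun i => val (f i)) 0%N (insub k)].

Lemma mi_box_ofE f (k : 'I_N) : mi_box_of f k = f k.
Proof. by rewrite fsfunE inE mem_iota/= add0n ltn_ord valK. Qed.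

Lemma mi_box_bounded f : mi_bounded N (mi_box_of f).
Proof. by move=> k Nk; rewrite fsfunE inE mem_iota/= add0n ltnNge Nk. Qed.

Lemma mi_box_of_inj : injective mi_box_of.
Proof.
by move=> f g fg; apply/ffunP => k; apply/val_inj; rewrite /= -!mi_box_ofE fg.
Qed.

Definition mi_box : seq multi_index :=
  [seq mi_box_of f | f <- enum (family (fun (k : 'I_N) (b : 'I_B) => b <= M k)%N)].

Lemma mi_box_uniq : uniq mi_box.
Proof. by rewrite map_inj_uniq ?enum_uniq//; exact: mi_box_of_inj. Qed.

Lemma mem_mi_box : [set j | mi_le j M] = [set` mi_box].
Proof.
apply/seteqP; split => [j /= jM|_ /mapP[f + ->]] /=; last first.
  rewrite mem_enum => /familyP fM k; have [kN|Nk] := ltnP k N.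
    by rewrite (mi_box_ofE f (Ordinal kN)); exact: fM.
  by rewrite mi_box_bounded.
pose f : {ffun 'I_N -> 'I_B} := [ffun k : 'I_N => inord (j k)].
have jB k : (k < N)%N -> (j k < B)%N.
  by move=> kN; exact: (leq_ltn_trans (jM k) (MB (Ordinal kN))).
apply/mapP; exists f.
  rewrite mem_enum; apply/familyP => k.
  by rewrite /in_mem/= ffunE inordK ?jB//; exact: jM.
apply/fsfunP => k; have [kN|Nk] := ltnP k N.
  by rewrite (mi_box_ofE f (Ordinal kN)) ffunE/= inordK// jB.
rewrite mi_box_bounded//; apply/eqP; rewrite -leqn0.
by have := jM k; rewrite (MN Nk).
Qed.

Lemma fsbig_mi_le (V : Type) (idx : V) (op : Monoid.com_law idx)
    (F : multi_index -> V) :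
  \big[op/idx]_(j \in [set j | mi_le j M]) F j = \big[op/idx]_(j <- mi_box) F j.
Proof. by rewrite mem_mi_box -fsbig_seq ?mi_box_uniq. Qed.

Lemma mi_box_le j : j \in mi_box -> mi_le j M.
Proof. by have := mem_mi_box => /seteqP[_ /(_ j)]. Qed.

(** The inner sums have different lengths; they are first widened to the common range ['I_B] with a
    side condition, and distributivity then turns the conditions into membership in a family. *)
Lemma prod_sum_mi_box (A : comNzRingType) (F : nat -> nat -> A) :
  \prod_(k < N) \sum_(b < (M k).+1) F k b =
  \sum_(j <- mi_box) \prod_(k < N) F k (j k).
Proof.
rewrite big_map big_enum/=.
under eq_bigr => k _ do rewrite (big_ord_widen _ (F k) (MB k)).
rewrite bigA_distr_big_dep; apply: eq_big => [f|f _].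
  by rewrite -[in LHS]topredE/=; apply: eq_forallb => k; rewrite /in_mem/= ltnS.
by apply: eq_bigr => k _; rewrite mi_box_ofE.
Qed.

End box.
End multi_index.

(** * Symmetric tensors and the system u, v *)

Section tensor_scaling.
Context {K : numFieldType} {theta : K -> K} {V : hilbertType theta}.

Lemma tpure_fupd0 n (T : tensor_power V n) (x : 'I_n -> V) i :
  tpure (fupd x i 0) = 0 :> T.
Proof.
have := @tpure_linear _ _ _ _ T x i 1 0 0.
rewrite !scale1r addr0 => /eqP; rewrite -[X in X == _]addr0 (inj_eq (addrI _)).
by rewrite eq_sym => /eqP.
Qed.

Lemma tpure_fupdZ n (T : tensor_power V n) (x : 'I_n -> V) i a y :
  tpure (fupd x i (a *: y)) = a *: tpure (fupd x i y) :> T.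
Proof. by rewrite -[a *: y]addr0 tpure_linear tpure_fupd0 addr0. Qed.

Lemma tpureZ n (T : tensor_power V n) (x : 'I_n -> V) a :
  tpure (fun i => a *: x i) = a ^+ n *: tpure x :> T.
Proof.
(* Multilinearity acts on one slot at a time, hence an induction on the number k of slots already
   scaled. *)
suff h k : (k <= n)%N ->
    tpure (fun i : 'I_n => if (i < k)%N then a *: x i else x i) =
    a ^+ k *: tpure x :> T.
  by rewrite -h//; congr tpure; apply/funext => i; rewrite ltn_ord.
elim: k => [_|k IH kn].
  by rewrite expr0 scale1r; congr tpure; apply/funext => i.
set y := fun i : 'I_n => if (i < k)%N then a *: x i else x i.
have -> : (fun i : 'I_n => if (i < k.+1)%N then a *: x i else x i) =
    fupd y (Ordinal kn) (a *: x (Ordinal kn)).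
  apply/funext => i; rewrite /fupd /y ltnS leq_eqVlt -val_eqE/=.
  by case: eqP => //= ik; congr (_ *: x _); exact: val_inj.
rewrite tpure_fupdZ exprS -scalerA; congr (_ *: _).
rewrite -IH; last exact: ltnW.
congr tpure; apply/funext => i; rewrite /fupd /y -val_eqE/=.
by case: eqP => // ik; rewrite ik ltnn; congr x; exact: val_inj.
Qed.

Lemma symm_seqZ n (T : tensor_power V n) a (s : seq V) :
  symm_seq T (map (fun v => a *: v) s) = a ^+ n *: symm_seq T s.
Proof.
rewrite /symm_seq /symm [RHS]scalerA mulrC -scalerA; congr (_ *: _).
rewrite scaler_sumr.
apply: eq_bigr => g _; rewrite -tpureZ; congr tpure; apply/funext => i.
have [is_|si] := ltnP (g i) (size s); first by rewrite (nth_map 0).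
(* Past the end of s the default entry is 0, which scaling fixes; the length of s is therefore
   irrelevant. *)
by rewrite !nth_default ?size_map// scaler0.
Qed.

End tensor_scaling.

Lemma mi_seq_map (V W : Type) (f : V -> W) (x : nat -> V) (m : multi_index) :
  mi_seq (f \o x) m = map f (mi_seq x m).
Proof.
rewrite /mi_seq map_flatten -map_comp; congr flatten; apply: eq_map => k /=.
by rewrite map_nseq.
Qed.

Lemma big_double (V : Type) (idx : V) (op : Monoid.law idx) (F : nat -> V) N :
  \big[op/idx]_(i < N.*2) F i = \big[op/idx]_(k < N) op (F k.*2) (F k.*2.+1).
Proof.
elim: N => [|N IH]; first by rewrite !big_ord0.
by rewrite doubleS !big_ord_recr/= IH Monoid.mulmA.
Qed.

Lemma flatten_double (V : Type) (F : nat -> seq V) N :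
  flatten [seq F i | i <- iota 0 N.*2] =
  flatten [seq F k.*2 ++ F k.*2.+1 | k <- iota 0 N].
Proof.
elim: N => // N IH.
rewrite doubleS -addn2 iotaD map_cat flatten_cat IH.
rewrite -[in RHS]addn1 iotaD map_cat flatten_cat.
by rewrite /= !add0n !cats0.
Qed.

Lemma mi_sumE N (m : multi_index) :
  mi_bounded N m -> mi_sum m = (\sum_(k < N) m k)%N.
Proof. by move=> mN; rewrite /mi_sum (big_finsupp _ (F := m) mN). Qed.

Section uv.
Context {R : realType} {H : realHilbertType R}.
Variable e : nat -> cplx H.

(** The two families are interleaved, u at even and v at odd places, because a complete orthonormal
    system is a single sequence. *)
Definition uv (i : nat) : dsum H H := if odd i then v10 e i./2 else u10 e i./2.

Variables (N : nat) (mp mq j : multi_index).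
Hypothesis MN : mi_bounded N (mi_add mp mq).
Hypothesis jM : mi_le j (mi_add mp mq).

(* The exponents, in the interleaved system u_0, v_0, u_1, v_1, ..., of the tensor
   described by [uv_seq]. *)
Definition uv_index : multi_index :=
  [fsfun i in [fset i in iota 0 N.*2]%fset =>
     if odd i then (mp i./2 + mq i./2 - j i./2)%N else j i./2].

Lemma uv_index_even k : (k < N)%N -> uv_index k.*2 = j k.
Proof.
by move=> kN; rewrite fsfunE inE mem_iota/= add0n ltn_double kN odd_double doubleK.
Qed.

Lemma uv_index_odd k : (k < N)%N -> uv_index k.*2.+1 = (mp k + mq k - j k)%N.
Proof.
move=> kN; rewrite fsfunE inE mem_iota/= add0n ltn_Sdouble kN odd_double/=.
by rewrite uphalf_double.
Qed.

Lemma uv_index_bounded : mi_bounded N.*2 uv_index.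
Proof. by move=> k Nk; rewrite fsfunE inE mem_iota/= add0n ltnNge Nk. Qed.

(** The places 2k and 2k+1 contribute j_k + (p_k + q_k - j_k), which is p_k + q_k because j <= p + q
    keeps the subtraction from being truncated. *)
Lemma mi_sum_uv_index : mi_sum uv_index = (mi_sum mp + mi_sum mq)%N.
Proof.
have Mle k : (N <= k)%N -> (mp k + mq k)%N = 0%N by move=> /MN; rewrite mi_addE.
rewrite (mi_sumE uv_index_bounded) big_double (@mi_sumE N mp); last first.
  by move=> k /Mle /eqP; rewrite addn_eq0 => /andP[/eqP].
rewrite (@mi_sumE N mq); last first.
  by move=> k /Mle /eqP; rewrite addn_eq0 => /andP[_ /eqP].
rewrite -big_split/=; apply: eq_bigr => k _.
by rewrite uv_index_even// uv_index_odd// subnKC//; have := jM k; rewrite mi_addE.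
Qed.

(** The block of k in [uv_seq] consists of the blocks 2k and 2k+1 of the interleaved system. The
    tensor thus has the form for which the value of the real integral is prescribed. *)
Lemma uv_seqE : uv_seq e mp mq j = mi_seq uv uv_index.
Proof.
rewrite /uv_seq (flatten_mi_supp MN); last first.
  move=> k Mk; have := jM k; rewrite Mk leqn0 => /eqP ->.
  by move: Mk; rewrite mi_addE => ->.
rewrite /mi_seq (flatten_mi_supp uv_index_bounded); last by move=> k ->.
rewrite flatten_double; congr flatten; apply/eq_in_map => k.
rewrite mem_iota add0n => /= kN.
by rewrite uv_index_even// uv_index_odd// /uv/= odd_double/= doubleK uphalf_double.
Qed.

Lemma prod_uv_index (A : comNzRingType) (F : nat -> dsum H H -> A) :
  (forall h, F 0%N h = 1) ->
  \prod_(i <- finsupp uv_index) F (uv_index i) (uv i) =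
  \prod_(k < N) (F (j k) (u10 e k) * F (mp k + mq k - j k)%N (v10 e k)).
Proof.
move=> F0.
rewrite (big_finsupp _ (F := fun i => F (uv_index i) (uv i)) uv_index_bounded).
  2: by move=> k ->.
rewrite (big_double _ (fun i => F (uv_index i) (uv i))); apply: eq_bigr => k _.
by rewrite uv_index_even// uv_index_odd// /uv/= odd_double/= doubleK uphalf_double.
Qed.

End uv.

Section prod_complex_hermite.
Context {R : realType}.
Variables (hermite : nat -> R -> R) (J : nat -> nat -> R[i] -> R[i]).
Hypothesis hermiteP : is_hermite hermite.
Hypothesis JP : is_complex_hermite J.
Variables (N : nat) (mp mq : multi_index).
Hypothesis MN : mi_bounded N (mi_add mp mq).

Lemma acoef00 : acoef 0 0 0 = 1 :> R[i].
Proof. by rewrite acoefE !expr0 mulr1 coef1. Qed.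

(** The one-variable expansions are multiplied out over the multi-indices j <= p + q. Factors
    outside the support equal 1, because [acoef 0 0 0] and [hermite 0] do. *)
Lemma prod_complex_hermite (x y : nat -> R) :
  \prod_(k <- finsupp (mi_add mp mq)) J (mp k) (mq k) (x k +i* y k) =
  \sum_(j <- mi_box N (mi_add mp mq)) acoef_prod mp mq j *
    (\prod_(k < N) (hermite (j k) (x k) * hermite (mp k + mq k - j k)%N (y k)))%:C.
Proof.
have M0 k : mi_add mp mq k = 0%N -> mp k = 0%N /\ mq k = 0%N.
  by rewrite mi_addE => /eqP; rewrite addn_eq0 => /andP[/eqP -> /eqP ->].
rewrite (big_finsupp _ (F := fun k => J (mp k) (mq k) (x k +i* y k)) MN); last first.
  move=> k /M0[-> ->]; rewrite (complex_hermiteE hermiteP JP) big_ord1.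
  by rewrite acoef00 !(hermite0 hermiteP) mulr1 mul1r.
under eq_bigr => k _ do rewrite (complex_hermiteE hermiteP JP) -mi_addE.
rewrite (@prod_sum_mi_box N (mi_add mp mq) _ (fun k b => acoef (mp k) (mq k) b *
  (hermite b (x k) * hermite (mi_add mp mq k - b) (y k))%:C)).
rewrite big_seq [RHS]big_seq; apply: eq_bigr => j /(mi_box_le MN) jM.
rewrite big_split/= rmorph_prod/=; congr (_ * _); last first.
  by apply: eq_bigr => k _; rewrite mi_addE.
rewrite /acoef_prod.
rewrite (big_finsupp _ (F := fun k => acoef (mp k) (mq k) (j k)) MN)// => k Mk.
have := jM k; rewrite Mk leqn0 => /eqP ->.
by have [-> ->] := M0 _ Mk; rewrite acoef00.
Qed.

End prod_complex_hermite.

(** * Linear spans, density and closures *)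

Section lspan.
Context {K : numFieldType} {V : normedModType K}.
Implicit Types (A B : set V) (x y : V).

Lemma denseP A : dense A <->
  forall x (eps : K), 0 < eps -> exists2 y, A y & `|x - y| < eps.
Proof.
split=> [dA x eps eps0|h O [x Ox] oO].
  have [y [By Ay]] : ball x eps `&` A !=set0.
    apply: dA; last exact: ball_open.
    by exists x; exact: ballxx.
  by exists y => //; move: By; rewrite -ball_normE.
have /nbhs_ballP[eps eps0 epsO] := open_nbhs_nbhs (conj oO Ox).
have [y Ay xy] := h x eps eps0.
by exists y; split => //; apply: epsO; rewrite -ball_normE.
Qed.

Lemma closureP A x : closure A x <->
  forall eps : K, 0 < eps -> exists2 y, A y & `|x - y| < eps.
Proof.
split=> [cA eps eps0|h U /nbhs_ballP[eps eps0 epsU]].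
  have [y [Ay By]] := cA _ (nbhsx_ballx x eps eps0).
  by exists y => //; move: By; rewrite -ball_normE.
have [y Ay xy] := h eps eps0.
by exists y; split => //; apply: epsU; rewrite -ball_normE.
Qed.

Lemma lspan_sub A : A `<=` lspan A.
Proof.
move=> x Ax; exists 1%N, (fun=> 1), (fun=> x); split => //.
by rewrite big_ord1 scale1r.
Qed.

Lemma lspan0 A : lspan A 0.
Proof. by exists 0%N, (fun=> 0), (fun=> 0); split => [[]//|]; rewrite big_ord0. Qed.

Lemma lspan_linear A a x y : lspan A x -> lspan A y -> lspan A (a *: x + y).
Proof.
move=> [n [b [v [Av ->]]]] [m [b' [v' [Av' ->]]]].
pose c (i : 'I_(n + m)) :=
  match fintype.split i with inl j => a * b j | inr j => b' j end.
pose z (i : 'I_(n + m)) :=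
  match fintype.split i with inl j => v j | inr j => v' j end.
exists (n + m)%N, c, z; rewrite /c /z; split.
  by move=> i; case: fintype.split.
rewrite big_split_ord/= scaler_sumr; congr (_ + _); apply: eq_bigr => i _.
  by rewrite (unsplitK (inl i)) scalerA.
by rewrite (unsplitK (inr i)).
Qed.

Lemma closure_lspan_linear A a x y :
  closure (lspan A) x -> closure (lspan A) y -> closure (lspan A) (a *: x + y).
Proof.
move=> /closureP cx /closureP cy; apply/closureP => eps eps0.
have a0 : 0 < `|a| + 1 by rewrite ltr_pwDr.
(* Adding 1 to |a| keeps the divisor positive when a = 0. *)
have [|x' Ax' xx'] := cx (eps / 2 / (`|a| + 1)); first by rewrite !divr_gt0.
have [|y' Ay' yy'] := cy (eps / 2); first by rewrite divr_gt0.
exists (a *: x' + y'); first exact: lspan_linear.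
rewrite opprD addrACA -scalerBr (le_lt_trans (ler_normD _ _))//.
rewrite (splitr eps) ler_ltD// normrZ.
move: xx'; rewrite ltr_pdivlMr// => /ltW; apply: le_trans.
by rewrite mulrC ler_wpM2l// lerDl.
Qed.

Lemma closure_lspan0 A : closure (lspan A) 0.
Proof. exact/subset_closure/lspan0. Qed.

End lspan.

Section closed_under_combinations.
Context {K : pzRingType} {V : lmodType K} (S : set V).
Hypothesis S0 : S 0.
Hypothesis Slin : forall a x y, S x -> S y -> S (a *: x + y).

Lemma linear_set_sum (I : eqType) (r : seq I) (a : I -> K) (t : I -> V) :
  (forall i, i \in r -> S (t i)) -> S (\sum_(i <- r) a i *: t i).
Proof.
move=> St; rewrite big_seq; elim/big_ind : _ => // [x y Sx Sy|i ir].
  by rewrite -[x]scale1r; exact: Slin.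
by rewrite -[_ *: _]addr0; apply: Slin => //; exact: St.
Qed.

End closed_under_combinations.

Lemma realinnerC {R : realType} {V : @Hilbert.type R idfun} (x y : V) :
  inner x y = inner y x.
Proof. by rewrite hermC/= expr0 mul1r. Qed.

(** * Orthonormality and totality of the interleaved system *)

Section uv_orthonormal.
Context {R : realType} {H : realHilbertType R}.
Variable e : nat -> cplx H.
Hypothesis e_orth : complete_orthogonal e.
Hypothesis e_norm : forall k, `|e k| = (Num.sqrt 2)%:C.

Let sqrt2_gt0 : 0 < Num.sqrt 2 :> R. Proof. by rewrite sqrtr_gt0. Qed.
Let sqrt2_neq0 : Num.sqrt 2 != 0 :> R. Proof. by rewrite gt_eqF. Qed.
Let sqr_sqrt2 : Num.sqrt 2 * Num.sqrt 2 = 2 :> R.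
Proof. by rewrite -expr2 sqr_sqrtr. Qed.

(** The complex integral is prescribed on orthonormal systems, whereas the e_k have norm sqrt 2. *)
Definition normalized (k : nat) : cplx H := (Num.sqrt 2)^-1%:C *: e k.

Lemma normalizedE k :
  normalized k = ((Num.sqrt 2)^-1 *: (e k).1, (Num.sqrt 2)^-1 *: (e k).2).
Proof.
rewrite /normalized /GRing.scale/= /cplx_scale/= !scale0r.
by rewrite subr0 add0r.
Qed.

Lemma normalizedK k : e k = (Num.sqrt 2)%:C *: normalized k.
Proof. by rewrite /normalized scalerA -rmorphM/= mulfV// scale1r. Qed.

Lemma normalized_orthonormal : complete_orthonormal normalized.
Proof.
have [eo ed] := e_orth; split; first split.
- by move=> j k jk; rewrite /normalized linearZl_LR linearZr_LR/= eo// !mulr0.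
- apply/denseP => x eps eps0.
  have /denseP/(_ x eps eps0)[y [n [a [v [ev ->]]]] xy] := ed.
  exists (\sum_(i < n) a i *: v i) => //.
  exists n, (fun i => a i * (Num.sqrt 2)%:C),
    (fun i => (Num.sqrt 2)^-1%:C *: v i); split.
    by move=> i; have [k _ <-] := ev i; exists k.
  by apply: eq_bigr => i _; rewrite scalerA -mulrA -rmorphM/= mulfV// mulr1.
- move=> k; rewrite /normalized normrZ e_norm normc_def/= expr0n/= addr0 sqrtr_sqr.
  by rewrite gtr0_norm ?invr_gt0// -rmorphM/= mulVf.
Qed.

Lemma inner_cplxE j k : inner (e j) (e k) =
  (inner (e j).1 (e k).1 + inner (e j).2 (e k).2) +i*
  (inner (e j).2 (e k).1 - inner (e j).1 (e k).2).
Proof. by []. Qed.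

(** Up to sign, the real inner products among the u and v are half the real and imaginary parts of
    those among the e_k: complex orthogonality yields all the real relations at once, and the factor
    1/2 normalizes <e_k, e_k> = 2. *)
Lemma inner_u10 j k :
  inner (u10 e j) (u10 e k) = 2^-1 * Re (inner (e j) (e k)).
Proof.
rewrite inner_cplxE/= /u10 linearZl_LR linearZr_LR/= mulrA -invfM sqr_sqrt2.
congr (_ * _); rewrite {1}/inner/= /dsum_inner/= linearNl linearNr/= opprK//.
Qed.

Lemma inner_v10 j k :
  inner (v10 e j) (v10 e k) = 2^-1 * Re (inner (e j) (e k)).
Proof.
rewrite inner_cplxE/= /v10 linearZl_LR linearZr_LR/= mulrA -invfM sqr_sqrt2.
by congr (_ * _); rewrite {1}/inner/= /dsum_inner/= addrC.
Qed.

Lemma inner_u10v10 j k :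
  inner (u10 e j) (v10 e k) = - (2^-1 * Im (inner (e j) (e k))).
Proof.
rewrite inner_cplxE/= /u10 /v10 linearZl_LR linearZr_LR/= mulrA -invfM sqr_sqrt2 -mulrN.
by congr (_ * _); rewrite {1}/inner/= /dsum_inner/= linearNl/= opprB addrC.
Qed.

Lemma inner_ee k : inner (e k) (e k) = 2%:C.
Proof. by rewrite inner_norm e_norm -rmorphXn/= sqr_sqrtr. Qed.

Lemma inner_v10u10 j k :
  inner (v10 e j) (u10 e k) = - (2^-1 * Im (inner (e k) (e j))).
Proof. by rewrite realinnerC inner_u10v10. Qed.

Let inner_uv := (inner_u10, inner_v10, inner_u10v10, inner_v10u10).

Lemma uv_inner i j : i != j -> inner (uv e i) (uv e j) = 0.
Proof.
move=> ij; have [eo _] := e_orth; rewrite /uv.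
(* With equal halves one vector is u_k and the other v_k, and the inner product is half the
   imaginary part of <e_k, e_k> = 2, up to sign. *)
have [hij|hij] := eqVneq i./2 j./2.
  rewrite hij; have : odd i != odd j.
    apply: contraNneq ij => oij.
    by rewrite -(odd_double_half i) -(odd_double_half j) hij oij.
  by case: (odd i) (odd j) => [] []// _; rewrite inner_uv inner_ee/= mulr0 oppr0.
by case: (odd i) (odd j) => [] []; rewrite inner_uv eo ?mulr0 ?oppr0// eq_sym.
Qed.

(** A real-linear bijection that divides norms by sqrt 2 and sends e_k to u_k and i e_k to - v_k. It
    carries the density of the complex span of the e_k to that of the real span of the u_k and
    v_k. *)
Definition cplx_dsum (x : cplx H) : dsum H H :=
  (Num.sqrt 2)^-1 *: ((x.1, - x.2) : dsum H H).

Lemma cplx_dsumB x y : cplx_dsum (x - y) = cplx_dsum x - cplx_dsum y.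
Proof.
rewrite /cplx_dsum -scalerBr; congr (_ *: _); congr pair => /=.
by rewrite opprB opprK addrC.
Qed.

Lemma cplx_dsumD x y : cplx_dsum (x + y) = cplx_dsum x + cplx_dsum y.
Proof.
rewrite /cplx_dsum -scalerDr; congr (_ *: _); congr pair => /=.
by rewrite opprD.
Qed.

Lemma cplx_dsum_norm x : (Num.sqrt 2 * `|cplx_dsum x|)%:C = `|x|.
Proof.
rewrite normrZ gtr0_norm ?invr_gt0// mulVKf//.
by rewrite /Num.norm/= /dsum_norm /cplx_norm/= normrN.
Qed.

Lemma cplx_dsumZ a k : cplx_dsum (a *: e k) =
  complex.Re a *: u10 e k - complex.Im a *: v10 e k.
Proof.
rewrite /cplx_dsum /u10 /v10 (scalerA (complex.Re a)) (scalerA (complex.Im a)).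
rewrite (mulrC (complex.Re a)) (mulrC (complex.Im a)) -!scalerA -scalerBr.
congr (_ *: _); congr pair => /=.
by rewrite scalerN opprD addrC.
Qed.

Lemma uv_orthonormal : complete_orthonormal (uv e).
Proof.
split; first split; first exact: uv_inner.
- apply/denseP => -[f g] eps eps0; have [_ /denseP ed] := e_orth.
  (* The preimage of (f, g) under [cplx_dsum]; approximating it within sqrt 2 eps approximates (f,
     g) within eps. *)
  pose x : cplx H := (Num.sqrt 2 *: f, - (Num.sqrt 2 *: g)).
  have xfg : cplx_dsum x = (f, g).
    by rewrite /cplx_dsum/= opprK; congr pair => /=; rewrite scalerA mulVf// scale1r.
  have eps20 : 0 < (Num.sqrt 2 * eps)%:C :> R[i] by rewrite ltcR mulr_gt0.
  have [_ [n [a [v [ev ->]]]]] := ed x _ eps20.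
  rewrite -cplx_dsum_norm ltcR ltr_pM2l// cplx_dsumB xfg.
  exists (cplx_dsum (\sum_(i < n) a i *: v i)) => //.
  have -> : cplx_dsum (\sum_(i < n) a i *: v i) = \sum_(i < n) cplx_dsum (a i *: v i).
    apply: (big_morph _ cplx_dsumD).
    by rewrite /cplx_dsum/= oppr0 scaler0.
  elim/big_ind : _ => [|s t ss tt|i _].
  + exact: lspan0.
  + by rewrite -[s]scale1r; exact: lspan_linear.
  + have [k _ <-] := ev i; rewrite cplx_dsumZ -scaleNr; apply: lspan_linear.
      by apply: lspan_sub; exists k.*2 => //; rewrite /uv odd_double doubleK.
    rewrite -[_ *: _]addr0; apply: lspan_linear; last exact: lspan0.
    by apply: lspan_sub; exists k.*2.+1 => //; rewrite /uv/= odd_double/= uphalf_double.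
- move=> i; apply/eqP; rewrite -(@eqrXn2 _ 2)// expr1n -inner_norm /uv.
  by case: (odd i); rewrite inner_uv inner_ee/= mulVf.
Qed.

End uv_orthonormal.

(** * Second moments and Wiener-Ito integrals *)

Section second_moment.
Context {R : realType} {d : measure_display} {Omega : measurableType d}.
Variable P : probability Omega R.
Implicit Types F G : Omega -> R.

Definition moment2 F : \bar R := ('E_P[fun w => (F w ^+ 2)%R])%E.

Lemma moment2E F : moment2 F = (\int[P]_w ((F w ^+ 2)%R)%:E)%E.
Proof. by rewrite /moment2 unlock. Qed.

Lemma moment2_ge0 F : (0 <= moment2 F)%E.
Proof. by rewrite moment2E integral_ge0// => w _; rewrite lee_fin sqr_ge0. Qed.

Lemma measurable_sqr_EFin F : measurable_fun setT F ->
  measurable_fun setT ((fun w => (F w ^+ 2)%:E) : Omega -> \bar R).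
Proof. by move=> mF; apply/measurable_EFinP; exact: measurable_funX. Qed.

Lemma moment2_eq0 F : measurable_fun setT F -> moment2 F = 0%E ->
  {ae P, forall w, F w = 0}.
Proof.
move=> mF; rewrite moment2E => F0.
have : (\int[P]_w `|((F w ^+ 2)%R)%:E| = 0)%E.
  by rewrite -[RHS]F0; apply: eq_integral => w _; rewrite gee0_abs// lee_fin sqr_ge0.
move=> /(ae_eq_integral_abs P measurableT (measurable_sqr_EFin mF)).
apply: filterS => w /(_ I) [/eqP]; by rewrite sqrf_eq0 => /eqP.
Qed.

Lemma ae_eq_moment2 F G : measurable_fun setT F -> measurable_fun setT G ->
  {ae P, forall w, F w = G w} -> moment2 F = moment2 G.
Proof.
move=> mF mG FG; rewrite !moment2E; apply: ge0_ae_eq_integral => //.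
- exact: measurable_sqr_EFin.
- exact: measurable_sqr_EFin.
- by move=> w _; rewrite lee_fin sqr_ge0.
- by move=> w _; rewrite lee_fin sqr_ge0.
- by apply: filterS FG => w -> _.
Qed.

(** From (a + b)^2 <= 2 a^2 + 2 b^2. The factor 2 is harmless, since the bound serves to show that a
    moment is arbitrarily small. *)
Lemma moment2_leD F G : measurable_fun setT F -> measurable_fun setT G ->
  (moment2 (fun w => (F w + G w)%R) <= 2%:E * moment2 F + 2%:E * moment2 G)%E.
Proof.
move=> mF mG; rewrite !moment2E.
have sq0 F' w : (0 <= ((F' w ^+ 2)%R)%:E :> \bar R)%E by rewrite lee_fin sqr_ge0.
have hZ F' : measurable_fun setT F' ->
    (2%:E * \int[P]_w ((F' w ^+ 2)%R)%:E = \int[P]_w (2%:E * ((F' w ^+ 2)%R)%:E))%E.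
  move=> mF'; rewrite ge0_integralZl//; exact: measurable_sqr_EFin.
rewrite !hZ// -ge0_integralD//; try by move=> w _; rewrite mule_ge0.
2,3: by apply: measurable_funeM; exact: measurable_sqr_EFin.
apply: ge0_le_integral => //.
- by move=> w _; rewrite lee_fin sqr_ge0.
- by apply: measurable_sqr_EFin; exact: measurable_funD.
- by apply: emeasurable_funD; apply: measurable_funeM; exact: measurable_sqr_EFin.
- move=> w _; rewrite -!EFinM -EFinD lee_fin.
  have := sqr_ge0 (F w - G w); nra.
Qed.

Lemma L2_measurable F : F \in Lfun P 2%:E -> measurable_fun setT F.
Proof. by move=> /sub_Lfun_mfun; rewrite inE. Qed.

Lemma L2norm_moment2 F (s : R) :
  0 <= s -> moment2 F = s%:E -> L2norm P F = (Num.sqrt s)%:E.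
Proof.
rewrite moment2E /L2norm unlock => s0 Fs.
have -> : (\int[P]_w (`|(EFin \o F) w| `^ 2%R))%E = s%:E.
  rewrite -Fs; apply: eq_integral => w _.
  rewrite [LHS](_ : _ = ((`|F w| `^ 2)%R)%:E)//.
  by rewrite powR_mulrn// -normrX ger0_norm// sqr_ge0.
by rewrite poweR_EFin powR12_sqrt.
Qed.

End second_moment.

Section ae_linear.
Context {R : realType} {d : measure_display} {Omega : measurableType d}.
Variable P : probability Omega R.
Context {K : pzRingType} {V : lmodType K}.
Variables (S : set V) (I : V -> Omega -> K).
Hypothesis S0 : S 0.
Hypothesis Slin : forall a x y, S x -> S y -> S (a *: x + y).
Hypothesis Ilin : forall a s t, S s -> S t ->
  {ae P, forall w, I (a *: s + t) w = a * I s w + I t w}.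

Lemma ae_linear0 : {ae P, forall w, I 0 w = 0}.
Proof.
(* Writing 0 as - 0 + 0 gives I 0 = - I 0 + I 0 almost surely. *)
have := Ilin (-1) S0 S0; apply: filterS => w.
by rewrite scaler0 addr0 mulN1r addNr.
Qed.

(** Linearity holds outside a null set that depends on the arguments; a finite sum involves only
    finitely many such sets. *)
Lemma ae_linear_sum (J : eqType) (r : seq J) (a : J -> K) (t : J -> V) :
  (forall i, i \in r -> S (t i)) ->
  {ae P, forall w,
    I (\sum_(i <- r) a i *: t i) w = \sum_(i <- r) a i * I (t i) w}.
Proof.
elim: r => [_|i r IH St].
  by apply: filterS ae_linear0 => w; rewrite !big_nil.
have Sr j : j \in r -> S (t j) by move=> jr; apply: St; rewrite inE jr orbT.
have Si : S (t i) by apply: St; rewrite mem_head.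
have := Ilin (a i) Si (linear_set_sum S0 Slin a Sr).
by apply: filterS2 (IH Sr) => w; rewrite !big_cons => -> ->.
Qed.

Lemma ae_linearB s t : S s -> S t -> {ae P, forall w, I (s - t) w = I s w - I t w}.
Proof.
move=> Ss St; have := Ilin (-1) St Ss; apply: filterS => w.
by rewrite scaleN1r mulN1r addrC [in RHS]addrC.
Qed.

End ae_linear.

Lemma ae_seq {R : realType} {d : measure_display} {Omega : measurableType d}
    (P : probability Omega R) (J : eqType) (r : seq J) (Q : J -> Omega -> Prop) :
  (forall i, i \in r -> {ae P, forall w, Q i w}) ->
  {ae P, forall w, forall i, i \in r -> Q i w}.
Proof.
elim: r => [_|i r IH Qr]; first exact: aeW.
have Qi : {ae P, forall w, Q i w} by apply: Qr; rewrite mem_head.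
have {}IH : {ae P, forall w, forall i, i \in r -> Q i w}.
  by apply: IH => j jr; apply: Qr; rewrite inE jr orbT.
apply: filterS2 Qi IH => w Qi Qr' j; rewrite inE => /predU1P[->//|]; exact: Qr'.
Qed.

Section isonormal_opp.
Context {R : realType} {d : measure_display} {Omega : measurableType d}.
Variable P : probability Omega R.
Context {H : @Hilbert.type R idfun}.
Variable X : H -> {RV P >-> R}.
Hypothesis Xiso : isonormal X.

Lemma isonormal_L2 h : (X h : Omega -> R) \in Lfun P 2%:E.
Proof.
have [_ /(_ h h) Xh] := Xiso.
have mX : measurable_fun setT (X h) by [].
rewrite inE; apply/andP; split; rewrite inE//=.
rewrite /finite_norm.
have := @L2norm_moment2 _ _ _ P (X h) (inner h h).
rewrite /L2norm => ->; first by rewrite ltry.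
  by rewrite inner_norm sqr_ge0.
by rewrite -Xh /moment2; congr expectation; apply/funext => w; rewrite expr2.
Qed.

(** Linearity is encoded in the covariance: the second moment of X(-h) + X(h) is <-h,-h> + 2 <-h,h>
    + <h,h> = 0. It is wanted because u_k has the component - e_k^2. *)
Lemma isonormal_opp h : {ae P, forall w, X (- h) w = - X h w}.
Proof.
have [_ Xh] := Xiso.
have m (k : H) : measurable_fun setT (X k) by [].
suff : {ae P, forall w, X (- h) w + X h w = 0}.
  by apply: filterS => w /eqP; rewrite addr_eq0 => /eqP.
apply: moment2_eq0; first exact: measurable_funD.
rewrite /moment2.
have L1 (k l : H) : (X k \* X l)%R \in Lfun P 1.
  by apply: Lfun2_mul_Lfun1; exact: isonormal_L2.
have -> : (fun w => (X (- h) w + X h w) ^+ 2) =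
   ((X (- h) \* X (- h)) \+ (X (- h) \* X h)) \+
   ((X (- h) \* X h) \+ (X h \* X h)).
  by apply/funext => w /=; ring.
rewrite expectationD; first last.
- exact: rpredD.
- exact: rpredD.
rewrite !expectationD//.
rewrite !Xh -!EFinD; congr EFin.
by rewrite linearNl linearNr linearNl/= ; ring.
Qed.

End isonormal_opp.

#[local] Existing Instance totally_filter.

Section sym_power.
Context {K : numFieldType} {theta : K -> K} {V : hilbertType theta}.

Lemma sym_power0 n (T : tensor_power V n) : sym_power T 0.
Proof. exact: closure_lspan0. Qed.

Lemma sym_power_linear n (T : tensor_power V n) a s t :
  sym_power T s -> sym_power T t -> sym_power T (a *: s + t).
Proof. exact: closure_lspan_linear. Qed.

Lemma sym_powerB n (T : tensor_power V n) s t :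
  sym_power T s -> sym_power T t -> sym_power T (s - t).
Proof.
by move=> Ss St; rewrite addrC -scaleN1r; exact: sym_power_linear.
Qed.

Lemma symm_seq_sym_power n (T : tensor_power V n) s : sym_power T (symm_seq T s).
Proof. by apply/subset_closure/lspan_sub; exists (fun i => s`_i). Qed.

Context {p q : nat} {Tp : tensor_power V p} {Tq : tensor_power V q}.
Variable S : tensor_product Tp Tq.

Lemma sym_power2_0 : sym_power2 S 0.
Proof. exact: closure_lspan0. Qed.

Lemma sym_power2_linear a s t :
  sym_power2 S s -> sym_power2 S t -> sym_power2 S (a *: s + t).
Proof. exact: closure_lspan_linear. Qed.

Lemma sym_power2B s t : sym_power2 S s -> sym_power2 S t -> sym_power2 S (s - t).
Proof.
by move=> Ss St; rewrite addrC -scaleN1r; exact: sym_power2_linear.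
Qed.

Lemma tprod_sym_power2 x y :
  sym_power Tp x -> sym_power Tq y -> sym_power2 S (tprod x y).
Proof. by move=> Sx Sy; apply/subset_closure/lspan_sub; exists x => //; exists y. Qed.

End sym_power.

Section wiener_ito.
Context {R : realType} {d : measure_display} {Omega : measurableType d}.
Variable P : probability Omega R.
Context {HH : @Hilbert.type R idfun} {n : nat}.
Variables (W : HH -> Omega -> R) (hermite : nat -> R -> R).
Variables (T : tensor_power HH n) (I : T -> Omega -> R).
Hypothesis hI : is_wiener_ito P W hermite I.

Lemma wiener_ito_L2 t : sym_power T t -> I t \in Lfun P 2%:E.
Proof. by move=> St; have [_ _ /(_ _ St)[]] := hI. Qed.

Lemma wiener_ito_measurable t : sym_power T t -> measurable_fun setT (I t).
Proof. by move=> St; exact: (L2_measurable (wiener_ito_L2 St)). Qed.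

Lemma wiener_ito_moment2 t : sym_power T t ->
  moment2 P (I t) = (n`!%:R * `|t| ^+ 2)%:E.
Proof. by move=> St; have [_ /(_ _ St)] := hI. Qed.

Lemma wiener_itoB s t : sym_power T s -> sym_power T t ->
  {ae P, forall w, I (s - t) w = I s w - I t w}.
Proof. have [lin _ _ _ _] := hI; exact: ae_linearB. Qed.

Lemma wiener_ito_inj s t : sym_power T s -> sym_power T t ->
  {ae P, forall w, I s w = I t w} -> s = t.
Proof.
move=> Ss St st; have Sst := sym_powerB Ss St.
have : moment2 P (I (s - t)) = 0%E.
  rewrite (@ae_eq_moment2 _ _ _ _ _ (cst 0))//.
  - rewrite moment2E; under eq_integral do rewrite /cst expr0n/=.
    exact: integral0.
  - exact: wiener_ito_measurable.
  - by apply: filterS2 (wiener_itoB Ss St) st => w -> ->; rewrite subrr.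
rewrite wiener_ito_moment2// => -[/eqP].
rewrite mulf_eq0 pnatr_eq0 gtn_eqF ?fact_gt0//= sqrf_eq0 normr_eq0 subr_eq0.
by move=> /eqP.
Qed.

End wiener_ito.

Section complex_norm.
Context {R : realType} {V : @Hilbert.type R[i] Num.conj}.

(** The norm of a complex space takes its values in [R[i]]; this real version can be compared with
    the norms of the real kernels. *)
Definition rnorm (x : V) : R := Re `|x|.

Lemma rnormE x : `|x| = (rnorm x)%:C.
Proof. by rewrite /rnorm RRe_real// ger0_real. Qed.

Lemma rnorm_ge0 x : 0 <= rnorm x.
Proof. by rewrite -ler0c -rnormE. Qed.

Lemma rnorm_sqr x : Re (`|x| ^+ 2) = rnorm x ^+ 2.
Proof. by rewrite rnormE -rmorphXn. Qed.

End complex_norm.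

(** * Real kernels of complex integrals *)

Section representation.
Context {R : realType} {d : measure_display} {Omega : measurableType d}.
Variable P : probability Omega R.
Context {HH : @Hilbert.type R idfun} {H : @Hilbert.type R idfun} {n p q : nat}.
Variables (W : HH -> Omega -> R) (hermite : nat -> R -> R).
Variables (T : tensor_power HH n) (I : T -> Omega -> R).
Hypothesis hI : is_wiener_ito P W hermite I.
Variables (Z : cplx H -> Omega -> R[i]) (J : nat -> nat -> R[i] -> R[i]).
Variables (Tp : tensor_power (cplx H) p) (Tq : tensor_power (cplx H) q).
Variables (S : tensor_product Tp Tq) (C : S -> Omega -> R[i]).
Hypothesis hC : is_complex_wiener_ito P Z J C.

Lemma complex_ito_measurable t : sym_power2 S t ->
  measurable_fun setT (fun w => Re (C t w)) /\
  measurable_fun setT (fun w => Im (C t w)).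
Proof. by have [L2 _ _ _] := hC; move=> /L2[/L2_measurable ? /L2_measurable]. Qed.

Lemma complex_ito_moment2 t : sym_power2 S t ->
  (moment2 P (fun w => Re (C t w)) + moment2 P (fun w => Im (C t w)) =
   (p`!%:R * q`!%:R * rnorm t ^+ 2)%:E)%E.
Proof.
move=> St; have [_ _ /(_ _ St) + _] := hC; rewrite rnorm_sqr => <-.
have [mRe mIm] := complex_ito_measurable St.
rewrite !moment2E unlock -ge0_integralD//.
- by apply: eq_integral => w _; rewrite sqr_normcE EFinD.
- by move=> w _; rewrite lee_fin sqr_ge0.
- exact: measurable_sqr_EFin.
- by move=> w _; rewrite lee_fin sqr_ge0.
- exact: measurable_sqr_EFin.
Qed.

(** Membership in the symmetric powers is part of the relation, so that it is stable under complex
    combinations and limits and the isometries always apply. *)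
Definition represents t s s' :=
  [/\ sym_power2 S t, sym_power T s, sym_power T s' &
    {ae P, forall w, C t w = I s w +i* I s' w}].

Lemma represents0 : represents 0 0 0.
Proof.
split; [exact: sym_power2_0|exact: sym_power0|exact: sym_power0|].
have [_ linC _ _] := hC; have [linI _ _ _ _] := hI.
have S0 : sym_power2 S 0 by exact: sym_power2_0.
have T0 : sym_power T 0 by exact: sym_power0.
have C0 := ae_linear0 S0 linC.
have I0 := ae_linear0 T0 linI.
by apply: filterS2 C0 I0 => w -> ->.
Qed.

(** Multiplying I s + i I s' by c and separating the parts gives the combinations of u and v with Re
    c and Im c that occur in the theorem. *)
Lemma represents_linear c t s s' t2 s2 s2' :
  represents t s s' -> represents t2 s2 s2' ->
  represents (c *: t + t2)
    (Re c *: s - Im c *: s' + s2) (Im c *: s + Re c *: s' + s2').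
Proof.
move=> [St Ss Ss' E] [St2 Ss2 Ss2' E2].
have [_ linC _ _] := hC; have [linI _ _ _ _] := hI.
split.
- exact: sym_power2_linear.
- by rewrite -addrA -scaleNr; do 2 apply: sym_power_linear => //.
- by rewrite -addrA; do 2 apply: sym_power_linear => //.
have Sa1 : sym_power T (- Im c *: s' + s2) by exact: sym_power_linear.
have Sa2 : sym_power T (Re c *: s' + s2') by exact: sym_power_linear.
have a1 := linI (- Im c) _ _ Ss' Ss2.
have b1 := linI (Re c) _ _ Ss Sa1.
have a2 := linI (Re c) _ _ Ss' Ss2'.
have b2 := linI (Im c) _ _ Ss Sa2.
have h := linC c _ _ St St2.
have h' : {ae P, forall w, C (c *: t + t2) w =
    c * (I s w +i* I s' w) + (I s2 w +i* I s2' w)}.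
  by apply: filterS3 h E E2 => w -> -> ->.
have h1 : {ae P, forall w, I (Re c *: s - Im c *: s' + s2) w =
    Re c * I s w + (- Im c * I s' w + I s2 w)}.
  by rewrite -addrA -scaleNr; apply: filterS2 b1 a1 => w -> ->.
have h2 : {ae P, forall w, I (Im c *: s + Re c *: s' + s2') w =
    Im c * I s w + (Re c * I s' w + I s2' w)}.
  by rewrite -addrA; apply: filterS2 b2 a2 => w -> ->.
apply: filterS3 h' h1 h2 => w -> -> ->.
by case: (c) => c1 c2; apply: complex_eqP => /=; ring.
Qed.

Lemma representsB t s s' t2 s2 s2' :
  represents t s s' -> represents t2 s2 s2' ->
  represents (t - t2) (s - s2) (s' - s2').
Proof.
move=> h h2; have := represents_linear (-1) h2 h.
rewrite /= !oppr0 !scale0r subr0 add0r !scaleN1r.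
by rewrite [- t2 + t]addrC [- s2 + s]addrC [- s2' + s']addrC.
Qed.

Lemma represents_sum (A : eqType) (r : seq A) (c : A -> R[i]) t s s' :
  (forall i, i \in r -> represents (t i) (s i) (s' i)) ->
  represents (\sum_(i <- r) c i *: t i)
    (\sum_(i <- r) (Re (c i) *: s i - Im (c i) *: s' i))
    (\sum_(i <- r) (Im (c i) *: s i + Re (c i) *: s' i)).
Proof.
elim: r => [|i r IH h]; first by rewrite !big_nil => _; exact: represents0.
rewrite !big_cons; apply: represents_linear; first by apply: h; rewrite mem_head.
by apply: IH => j jr; apply: h; rewrite inE jr orbT.
Qed.

Lemma represents_norm t s s' : represents t s s' ->
  n`!%:R * (`|s| ^+ 2 + `|s'| ^+ 2) = p`!%:R * q`!%:R * rnorm t ^+ 2.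
Proof.
move=> [St Ss Ss' E]; have [mRe mIm] := complex_ito_measurable St.
have ms := wiener_ito_measurable hI Ss; have ms' := wiener_ito_measurable hI Ss'.
have := complex_ito_moment2 St.
rewrite (ae_eq_moment2 mRe ms); last by apply: filterS E => w ->.
rewrite (ae_eq_moment2 mIm ms'); last by apply: filterS E => w ->.
by rewrite !(wiener_ito_moment2 hI)// -EFinD -mulrDr => -[].
Qed.

(** In the norm identity n! >= 1, and the square of the other kernel can be discarded. The constant
    does not depend on t, so differences of tensors control differences of kernels. *)
Lemma represents_normP t s s' : represents t s s' ->
  `|s| <= Num.sqrt (p`!%:R * q`!%:R) * rnorm t /\
  `|s'| <= Num.sqrt (p`!%:R * q`!%:R) * rnorm t.
Proof.
move=> /represents_norm h.
have n1 : 1 <= n`!%:R :> R by rewrite ler1n fact_gt0.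
have pq0 : 0 <= p`!%:R * q`!%:R :> R by rewrite mulr_ge0.
have b (x : T) : `|x| ^+ 2 <= p`!%:R * q`!%:R * rnorm t ^+ 2 ->
    `|x| <= Num.sqrt (p`!%:R * q`!%:R) * rnorm t.
  move=> xh; rewrite -(@ler_pXn2r _ 2) ?nnegrE ?mulr_ge0 ?sqrtr_ge0 ?rnorm_ge0//.
  by rewrite exprMn sqr_sqrtr.
have := sqr_ge0 `|s|; have := sqr_ge0 `|s'|.
by split; apply: b; nra.
Qed.

Section limit.
Context {D : choiceType}.
Variables (t : {fset D} -> S) (s s' : {fset D} -> T) (f : S).
Hypothesis tss' : forall A, represents (t A) (s A) (s' A).
Hypothesis tf : t @ totally --> f.

Lemma rnorm_cvg (eps : R) :
  0 < eps -> \forall A \near totally, rnorm (f - t A) < eps.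
Proof.
move=> eps0; have eps0' : 0 < eps%:C :> R[i] by rewrite ltcR.
have /cvgrPdist_lt /(_ _ eps0') := tf; apply: filterS => A.
by rewrite rnormE ltcR.
Qed.

Lemma represents_cauchy : cvg (s @ totally) /\ cvg (s' @ totally).
Proof.
set c := Num.sqrt (p`!%:R * q`!%:R) : R.
have c0 : 0 <= c by rewrite sqrtr_ge0.
suff h (eps : R) : 0 < eps -> exists A0, \forall A \near totally,
    `|s A0 - s A| < eps /\ `|s' A0 - s' A| < eps.
  split; apply: cauchy_cvg; apply/cauchyP => eps /h[A0 hA].
    by exists (s A0); apply: filterS hA => A [hA _]; rewrite -ball_normE.
  by exists (s' A0); apply: filterS hA => A [_ hA]; rewrite -ball_normE.
(* Two tensors within del of f are within 2 del of each other, and c times 2 del is less than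
   eps. *)
move=> eps0; pose del := eps / (2 * (c + 1)).
have del0 : 0 < del by rewrite divr_gt0// mulr_gt0// ltr_pwDr.
have near_f := rnorm_cvg del0.
have [A0 hA0] := filter_ex near_f.
exists A0; apply: filterS near_f => A hA.
have [b1 b2] := represents_normP (representsB (tss' A0) (tss' A)).
have lt : c * rnorm (t A0 - t A) < eps.
  have tri : rnorm (t A0 - t A) < 2 * del.
    have := ler_normD (f - t A) (t A0 - f).
    rewrite addrC subrKA [ `|t A0 - f| ]distrC !rnormE -rmorphD lecR; lra.
  have := rnorm_ge0 (t A0 - t A).
  have : 2 * del * (c + 1) = eps by rewrite /del; field; rewrite gt_eqF// ltr_pwDr.
  nra.
by split; apply: le_lt_trans lt.
Qed.

(** Almost surely Re (C f) - I g = Re (C (f - t A)) + I (s A - g), and likewise for the imaginary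
    part. By the isometries the second moment of the right side is arbitrarily small, so that of the
    left side, independent of A, is 0. *)
Lemma represents_limit g g' : s @ totally --> g -> s' @ totally --> g' ->
  sym_power2 S f -> represents f g g'.
Proof.
move=> sg s'g' Sf.
have cl (x : {fset D} -> T) y :
    (forall A, sym_power T (x A)) -> x @ totally --> y -> sym_power T y.
  move=> Sx xy; apply: (@closed_cvg _ _ totally _ x (sym_power T) _ _ y xy).
    exact: closed_closure.
  exact: nearW.
have Ss A : sym_power T (s A) by have [] := tss' A.
have Ss' A : sym_power T (s' A) by have [] := tss' A.
have Sg := cl _ _ Ss sg; have Sg' := cl _ _ Ss' s'g'.
split => //.
have [mRe mIm] := complex_ito_measurable Sf.
have [_ linC _ _] := hC.
(* Chosen so that both bounds in [small] are at most eps once all the squares are at most eps /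
   c. *)
pose c : R := 2 * (p`!%:R * q`!%:R + n`!%:R).
have c0 : 0 < c by rewrite mulr_gt0// ltr_wpDl// ?mulr_ge0// ltr0n fact_gt0.
have small (eps : R) : 0 < eps -> exists A,
    [/\ 2 * (p`!%:R * q`!%:R * rnorm (f - t A) ^+ 2) +
        2 * (n`!%:R * `|s A - g| ^+ 2) <= eps &
     2 * (p`!%:R * q`!%:R * rnorm (f - t A) ^+ 2) +
        2 * (n`!%:R * `|s' A - g'| ^+ 2) <= eps].
  (* A nonnegative x below both 1 and eps / c satisfies x^2 <= eps / c, without a square root. *)
  move=> eps0; pose del := Num.min 1 (eps / c).
  have del0 : 0 < del by rewrite lt_min ltr01 divr_gt0.
  have /cvgrPdist_lt /(_ _ del0) h1 := sg.
  have /cvgrPdist_lt /(_ _ del0) h2 := s'g'.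
  have [A [[hA h1A] h2A]] :=
    filter_ex (filterI (filterI (rnorm_cvg del0) h1) h2).
  have d2 (x : R) : 0 <= x -> x < del -> x ^+ 2 <= eps / c.
    rewrite lt_min => x0 /andP[x1 xc]; nra.
  set k := eps / c in d2.
  have cE : eps = 2 * (p`!%:R * q`!%:R * k) + 2 * (n`!%:R * k).
    transitivity (c * k); last by rewrite /c; ring.
    by rewrite /k mulrCA mulfV ?mulr1// gt_eqF.
  have r2 := d2 _ (rnorm_ge0 _) hA.
  have g2 := d2 _ (normr_ge0 _) h1A.
  have g2' := d2 _ (normr_ge0 _) h2A.
  have pq0 : 0 <= p`!%:R * q`!%:R :> R by rewrite mulr_ge0.
  have n0 : 0 <= n`!%:R :> R by [].
  exists A; rewrite [ `|s A - g| ]distrC [ `|s' A - g'| ]distrC.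
  have := ler_wpM2l pq0 r2; have := ler_wpM2l n0 g2; have := ler_wpM2l n0 g2'.
  by split; lra.
(* Abstracting over [re] treats both parts at once; the second moment of either is at most that of
   the whole. *)
have part_limit (re : R[i] -> R) (x : {fset D} -> T) (y : T) :
    (forall u v, re (u + v) = re u + re v) ->
    (forall t, sym_power2 S t -> measurable_fun setT (fun w => re (C t w))) ->
    (forall t, sym_power2 S t -> (moment2 P (fun w => re (C t w)) <=
      (p`!%:R * q`!%:R * rnorm t ^+ 2)%:E)%E) ->
    (forall A, sym_power T (x A)) -> sym_power T y ->
    (forall A, {ae P, forall w, re (C (t A) w) = I (x A) w}) ->
    (forall eps : R, 0 < eps -> exists A,
      2 * (p`!%:R * q`!%:R * rnorm (f - t A) ^+ 2) +
        2 * (n`!%:R * `|x A - y| ^+ 2) <= eps) ->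
    {ae P, forall w, re (C f w) = I y w}.
  move=> reD mre mom Sx Sy tx sm.
  have my := wiener_ito_measurable hI Sy.
  suff : {ae P, forall w, re (C f w) - I y w = 0}.
    by apply: filterS => w /eqP; rewrite subr_eq0 => /eqP.
  have mD : measurable_fun setT (fun w => re (C f w) - I y w).
    by apply: measurable_funB => //; exact: mre.
  apply: moment2_eq0 => //; apply/eqP; rewrite eq_le moment2_ge0 andbT.
  apply/lee_addgt0Pr => eps /sm[A hA]; rewrite add0e.
  have [St _ _ _] := tss' A.
  have Sft := sym_power2B Sf St; have Sxy := sym_powerB (Sx A) Sy.
  have mft := mre _ Sft; have mxy := wiener_ito_measurable hI Sxy.
  suff E : {ae P, forall w,
      re (C f w) - I y w = re (C (f - t A) w) + I (x A - y) w}.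
    rewrite (ae_eq_moment2 mD (measurable_funD mft mxy) E).
    apply: le_trans (moment2_leD P mft mxy) _.
    rewrite (wiener_ito_moment2 hI)//.
    apply: (@le_trans _ _ (2 * (p`!%:R * q`!%:R * rnorm (f - t A) ^+ 2) +
        2 * (n`!%:R * `|x A - y| ^+ 2))%:E); last by rewrite lee_fin.
    rewrite [leRHS]EFinD; apply: leeD; rewrite [leRHS]EFinM//.
    by rewrite lee_wpmul2l//; exact: mom.
  have Cft := ae_linearB linC Sf St.
  have Ixy := wiener_itoB hI (Sx A) Sy.
  apply: filterS3 Cft Ixy (tx A) => w /= -> -> <-.
  by rewrite -[in LHS](subrK (C (t A) w) (C f w)) reD; ring.
have hRe : {ae P, forall w, Re (C f w) = I g w}.
  apply: (part_limit (@complex.Re R) s) => //.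
  - exact: cReD.
  - by move=> u /complex_ito_measurable[].
  - by move=> u Su; rewrite -complex_ito_moment2// leeDl// moment2_ge0.
  - by move=> A; have [_ _ _ +] := tss' A; apply: filterS => w ->.
  - by move=> eps /small[A [? _]]; exists A.
have hIm : {ae P, forall w, Im (C f w) = I g' w}.
  apply: (part_limit (@complex.Im R) s') => //.
  - exact: cImD.
  - by move=> u /complex_ito_measurable[].
  - by move=> u Su; rewrite -complex_ito_moment2// leeDr// moment2_ge0.
  - by move=> A; have [_ _ _ +] := tss' A; apply: filterS => w ->.
  - by move=> eps /small[A [_ ?]]; exists A.
by apply: filterS2 hRe hIm => w hRe hIm; exact: complex_eqP.
Qed.
End limit.

End representation.

(** * Representation of the basis tensors *)

Lemma cplx_conjZ {R : realType} {H : @Hilbert.type R idfun}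
    (r : R) (x : cplx H) :
  cplx_conj (r%:C *: x) = r%:C *: cplx_conj x.
Proof.
rewrite /cplx_conj /GRing.scale/= /cplx_scale/= !scale0r !subr0 !add0r.
by rewrite scalerN.
Qed.

Section basis.
Context {R : realType} {H : @Hilbert.type R idfun}.
Context {d : measure_display} {Omega : measurableType d}.
Variable P : probability Omega R.
Variables (X Y : H -> {RV P >-> R}).
Variables (hermite : nat -> R -> R) (J : nat -> nat -> R[i] -> R[i]).
Variables (e : nat -> cplx H) (p q : nat).
Variables (T : tensor_power (dsum H H) (p + q)).
Variables (Tp : tensor_power (cplx H) p) (Tq : tensor_power (cplx H) q).
Variables (Tpq : tensor_product Tp Tq).
Variables (I : T -> Omega -> R) (Ipq : Tpq -> Omega -> R[i]).
Hypothesis Yiso : isonormal Y.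
Hypothesis hermiteP : is_hermite hermite.
Hypothesis JP : is_complex_hermite J.
Hypothesis hI : is_wiener_ito P (process_sum X Y) hermite I.
Hypothesis hC : is_complex_wiener_ito P (complex_process X Y) J Ipq.
Hypothesis e_orth : complete_orthogonal e.
Hypothesis e_norm : forall k, `|e k| = (Num.sqrt 2)%:C.

Let W := process_sum X Y.
Let Z := complex_process X Y.

(** The factor sqrt 2 cancels the one in Z. With h = e_k / sqrt 2, the real part X(h^1) - Y(h^2) is
    a value of W only after Y(-h^2) = - Y(h^2), which is why the equality is almost sure. *)
Lemma complex_process_normalized k : {ae P, forall w,
  (Num.sqrt 2)%:C * Z (normalized e k) w = W (u10 e k) w +i* W (v10 e k) w}.
Proof.
have s2 : Num.sqrt 2 != 0 :> R by rewrite gt_eqF// sqrtr_gt0.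
have := isonormal_opp Yiso ((Num.sqrt 2)^-1 *: (e k).2); apply: filterS => w Yo.
rewrite /Z /complex_process mulrC divfK; last by rewrite eq_complex/= (negPf s2).
rewrite normalizedE /W /process_sum /u10 /v10/= scalerN Yo.
by apply: complex_eqP => /=; ring.
Qed.

Variables (mp mq : multi_index).
Hypothesis (mpE : mi_sum mp == p) (mqE : mi_sum mq == q).

Let f : Tpq := tprod (symm_seq Tp (mi_seq e mp))
  (symm_seq Tq (mi_seq (cplx_conj \o e) mq)).
Let f' : Tpq := tprod (symm_seq Tp (mi_seq (normalized e) mp))
  (symm_seq Tq (mi_seq (cplx_conj \o normalized e) mq)).

Lemma symm_normalized : f = (Num.sqrt 2)%:C ^+ (p + q) *: f'.
Proof.
have eE : e = (fun x => (Num.sqrt 2)%:C *: x) \o normalized e.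
  by apply/funext => k; exact: normalizedK.
have ceE : cplx_conj \o e =
    (fun x => (Num.sqrt 2)%:C *: x) \o (cplx_conj \o normalized e).
  by apply/funext => k /=; rewrite -cplx_conjZ -normalizedK.
pose sc (x : cplx H) := (Num.sqrt 2)%:C *: x.
rewrite /f ceE {1}eE (mi_seq_map sc (normalized e)).
rewrite (mi_seq_map sc (cplx_conj \o normalized e)) !symm_seqZ.
by rewrite linearZl_LR linearZr_LR/= scalerA -exprD.
Qed.

(** Passing from the e_k to the normalized system costs sqrt 2 ^ (p + q), which cancels the product
    of the factors 2^(-(p_k + q_k) / 2) in the prescribed value of the integral. *)
Lemma complex_ito_basis : {ae P, forall w,
  Ipq f w = \prod_(k <- finsupp (mi_add mp mq))
    J (mp k) (mq k) (W (u10 e k) w +i* W (v10 e k) w)}.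
Proof.
have s2 : Num.sqrt 2 != 0 :> R by rewrite gt_eqF// sqrtr_gt0.
have Sf' : sym_power2 Tpq f'.
  by apply: tprod_sym_power2; exact: symm_seq_sym_power.
have T0 : sym_power2 Tpq 0 by exact: sym_power2_0.
have [_ linC _ basis] := hC.
have h1 := linC ((Num.sqrt 2)%:C ^+ (p + q)) _ _ Sf' T0.
have h0 := ae_linear0 T0 linC.
have hb := basis (normalized e) (exist _ mp mpE) (exist _ mq mqE)
  (normalized_orthonormal e_orth e_norm).
have hZ : {ae P, forall w, forall k, (Num.sqrt 2)%:C * Z (normalized e k) w =
    W (u10 e k) w +i* W (v10 e k) w}.
  by apply/ae_foralln => k; exact: complex_process_normalized.
have {h1 h0} h1 : {ae P, forall w,
    Ipq f w = (Num.sqrt 2)%:C ^+ (p + q) * Ipq f' w}.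
  by rewrite symm_normalized; apply: filterS2 h1 h0 => w + E; rewrite E !addr0.
apply: filterS3 h1 hb hZ => w -> -> Zw /=.
under eq_bigr => k _ do rewrite Zw.
rewrite big_split/= mulrA -[RHS]mul1r; congr (_ * _).
have [N MN] := mi_bounded_ex (mi_add mp mq).
have Mle k : (N <= k)%N -> (mp k + mq k)%N = 0%N by move=> /MN; rewrite mi_addE.
rewrite (big_finsupp _ (F := fun k => (Num.sqrt 2 ^- (mp k + mq k))%:C) MN).
  2: by move=> k; rewrite mi_addE => ->; rewrite expr0 invr1.
have -> : \prod_(k < N) (Num.sqrt 2 ^- (mp k + mq k))%:C =
    ((Num.sqrt 2)^-1 ^+ (\sum_(k < N) (mp k + mq k)))%:C :> R[i].
  by rewrite -prodrXr rmorph_prod; apply: eq_bigr => k _; rewrite exprVn.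
rewrite big_split/= -!mi_sumE ?(eqP mpE) ?(eqP mqE); last 2 first.
- by move=> k /Mle /eqP; rewrite addn_eq0 => /andP[_ /eqP].
- by move=> k /Mle /eqP; rewrite addn_eq0 => /andP[/eqP].
by rewrite -rmorphXn -rmorphM/= -exprMn mulfV// expr1n.
Qed.

Lemma ito_basis j : mi_le j (mi_add mp mq) ->
  forall N, mi_bounded N (mi_add mp mq) -> {ae P, forall w,
  I (symm_seq T (uv_seq e mp mq j)) w =
  \prod_(k < N) (hermite (j k) (W (u10 e k) w) *
    hermite (mp k + mq k - j k)%N (W (v10 e k) w))}.
Proof.
move=> jM N MN; have [_ _ _ _ basis] := hI.
have E : mi_sum (uv_index N mp mq j) == (p + q)%N.
  by rewrite mi_sum_uv_index// (eqP mpE) (eqP mqE).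
have := basis (uv e) (exist (fun m => mi_sum m == (p + q)%N) _ E)
  (uv_orthonormal e_orth e_norm).
rewrite /= -(uv_seqE e MN jM); apply: filterS => w ->.
rewrite -(prod_uv_index e N mp mq j (F := fun n h => hermite n (W h w)))// => h.
exact: hermite0.
Qed.

(** The products of real Hermite polynomials are real, so the real and imaginary parts of the
    expansion come from [acoef_prod] alone, and these are the coefficients of the two kernels. *)
Lemma represents_basis :
  represents P I Ipq f (ukernel e T mp mq) (vkernel e T mp mq).
Proof.
have [N MN] := mi_bounded_ex (mi_add mp mq).
have Ss s : sym_power T (symm_seq T s) by exact: symm_seq_sym_power.
have T0 : sym_power T 0 by exact: sym_power0.
have Tlin := @sym_power_linear _ _ _ _ T.
have [linI _ _ _ _] := hI.
have uE : ukernel e T mp mq = \sum_(j <- mi_box N (mi_add mp mq))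
    Re (acoef_prod mp mq j) *: symm_seq T (uv_seq e mp mq j).
  by rewrite /ukernel (fsbig_mi_le MN).
have vE : vkernel e T mp mq = \sum_(j <- mi_box N (mi_add mp mq))
    Im (acoef_prod mp mq j) *: symm_seq T (uv_seq e mp mq j).
  by rewrite /vkernel (fsbig_mi_le MN).
split.
- by apply: tprod_sym_power2; exact: symm_seq_sym_power.
- by rewrite uE; exact: linear_set_sum.
- by rewrite vE; exact: linear_set_sum.
have hu : {ae P, forall w, I (ukernel e T mp mq) w =
    \sum_(j <- mi_box N (mi_add mp mq))
    Re (acoef_prod mp mq j) * I (symm_seq T (uv_seq e mp mq j)) w}.
  by rewrite uE; exact: (ae_linear_sum T0 Tlin linI).
have hv : {ae P, forall w, I (vkernel e T mp mq) w =
    \sum_(j <- mi_box N (mi_add mp mq))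
    Im (acoef_prod mp mq j) * I (symm_seq T (uv_seq e mp mq j)) w}.
  by rewrite vE; exact: (ae_linear_sum T0 Tlin linI).
have hb : {ae P, forall w, forall j, j \in mi_box N (mi_add mp mq) ->
    I (symm_seq T (uv_seq e mp mq j)) w =
    \prod_(k < N) (hermite (j k) (W (u10 e k) w) *
      hermite (mp k + mq k - j k)%N (W (v10 e k) w))}.
  by apply: ae_seq => j /(mi_box_le MN) jM; exact: ito_basis.
have hw : {ae P, forall w, I (ukernel e T mp mq) w +i* I (vkernel e T mp mq) w =
    \sum_(j <- mi_box N (mi_add mp mq)) acoef_prod mp mq j *
    (\prod_(k < N) (hermite (j k) (W (u10 e k) w) *
      hermite (mp k + mq k - j k)%N (W (v10 e k) w)))%:C}.
  apply: filterS3 hu hv hb => w -> -> Iw.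
  apply: complex_eqP; rewrite ?Re_sum ?Im_sum/=.
    by apply: eq_big_seq => j /Iw ->; rewrite cReM/= mulr0 subr0.
  by apply: eq_big_seq => j /Iw ->; rewrite cImM/= mulr0 add0r.
apply: filterS2 complex_ito_basis hw => w -> ->.
exact: prod_complex_hermite.
Qed.

End basis.

(** * Convergence of the series and uniqueness of the kernels *)

(** By the isometry the L2 distance of a partial sum to I g is sqrt n! times the distance of the
    corresponding tensors, so convergence of kernels passes to integrals. *)
Lemma wiener_ito_L2_sum {R : realType} {d : measure_display}
    {Omega : measurableType d} (P : probability Omega R) {HH : @Hilbert.type R idfun} {n : nat}
    (W : HH -> Omega -> R) (hermite : nat -> R -> R)
    (T : tensor_power HH n) (I : T -> Omega -> R)
    (D : choiceType) (s : D -> T) (g : T) :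
  is_wiener_ito P W hermite I ->
  (forall m, sym_power T (s m)) -> sym_power T g ->
  partial_sum s @ totally --> g -> L2_sum P (fun m => I (s m)) (I g).
Proof.
move=> hI Ss Sg sg; have [linI _ _ _ _] := hI.
have T0 : sym_power T 0 by exact: sym_power0.
have Tlin := @sym_power_linear _ _ _ _ T.
split; [by move=> m; exact: (wiener_ito_L2 hI)|exact: (wiener_ito_L2 hI)|].
have norm_eq A : L2norm P (partial_sum (fun m => I (s m)) A \- I g) =
    (Num.sqrt n`!%:R * `|partial_sum s A - g|)%:E.
  have SA : sym_power T (partial_sum s A).
    rewrite partial_sumE (eq_bigr (fun m => 1 *: s m)).
      2: by move=> m _; rewrite scale1r.
    exact: linear_set_sum.
  have SAg := sym_powerB SA Sg.
  have mA : measurable_fun setT (partial_sum (fun m => I (s m)) A).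
    rewrite partial_sumE.
    rewrite (_ : \sum_(i <- A) I (s i) = fun w => \sum_(i <- A) I (s i) w).
      by apply: measurable_sum => m; exact: (wiener_ito_measurable hI).
    by apply/funext => w; rewrite fct_sumE.
  have E : {ae P, forall w, (partial_sum (fun m => I (s m)) A \- I g) w =
      I (partial_sum s A - g) w}.
    have sumA : {ae P, forall w, I (partial_sum s A) w = \sum_(i <- A) I (s i) w}.
      have := ae_linear_sum T0 Tlin linI (fun=> 1) (t := s) (r := A)
        (fun i _ => Ss i).
      rewrite partial_sumE; under eq_bigr do rewrite scale1r.
      by apply: filterS => w ->; apply: eq_bigr => i _; rewrite mul1r.
    apply: filterS2 (wiener_itoB hI SA Sg) sumA => w -> ->.
    by rewrite /= partial_sumE fct_sumE.
  rewrite (@L2norm_moment2 _ _ _ _ _ (n`!%:R * `|partial_sum s A - g| ^+ 2)).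
  - by rewrite sqrtrM// sqrtr_sqr normr_id.
  - by rewrite mulr_ge0// sqr_ge0.
  - rewrite -(wiener_ito_moment2 hI SAg); apply: ae_eq_moment2 => //.
      apply: measurable_funB => //; exact: (wiener_ito_measurable hI).
    exact: (wiener_ito_measurable hI).
under eq_cvg do rewrite norm_eq.
apply: cvg_EFin; first exact: nearW.
rewrite -(mulr0 (Num.sqrt n`!%:R)); apply: cvgMr.
by apply/norm_cvg0P; rewrite -(subrr g); apply: cvgB => //; exact: cvg_cst.
Qed.

Theorem theorem3p3 (R : realType) (H : realHilbertType R)
    (d : measure_display) (Omega : measurableType d) (P : probability Omega R)
    (X Y : H -> {RV P >-> R})
    (hermite : nat -> R -> R) (J : nat -> nat -> R[i] -> R[i])
    (e : nat -> cplx H) (p q : nat)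
    (T : tensor_power (dsum H H) (p + q))
    (Tp : tensor_power (cplx H) p) (Tq : tensor_power (cplx H) q)
    (Tpq : tensor_product Tp Tq)
    (I : T -> Omega -> R) (Ipq : Tpq -> Omega -> R[i])
    (f : Tpq) (c : multi_index_of p -> multi_index_of q -> R[i]) :
  separable H ->
  isonormal X -> isonormal Y -> independent_families X Y ->
  is_hermite hermite -> is_complex_hermite J ->
  is_wiener_ito P (process_sum X Y) hermite I ->
  is_complex_wiener_ito P (complex_process X Y) J Ipq ->
  complete_orthogonal e -> (forall k, `|e k| = (Num.sqrt 2)%:C) ->
  sym_power2 Tpq f ->
  (\esum_(m in [set: multi_index_of p * multi_index_of q])
     (complex.Re (`|c m.1 m.2| ^+ 2))%:E < +oo)%E ->
  partial_sum (fun m : multi_index_of p * multi_index_of q =>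
    c m.1 m.2 *: (tprod (symm_seq Tp (mi_seq e (val m.1)))
                        (symm_seq Tq (mi_seq (cplx_conj \o e) (val m.2))) : Tpq))
    @ totally --> f ->
  let u (m : multi_index_of p * multi_index_of q) :=
    ukernel e T (val m.1) (val m.2) in
  let v (m : multi_index_of p * multi_index_of q) :=
    vkernel e T (val m.1) (val m.2) in
  let kRe (m : multi_index_of p * multi_index_of q) : T :=
    complex.Re (c m.1 m.2) *: u m - complex.Im (c m.1 m.2) *: v m in
  let kIm (m : multi_index_of p * multi_index_of q) : T :=
    complex.Im (c m.1 m.2) *: u m + complex.Re (c m.1 m.2) *: v m in
  (exists FRe FIm : Omega -> R,
     [/\ L2_sum P (fun m => I (kRe m)) FRe,
         L2_sum P (fun m => I (kIm m)) FIm &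
         {ae P, forall w, Ipq f w = FRe w +i* FIm w}]) /\
  (exists gRe gIm : T,
     [/\ sym_power T gRe /\ sym_power T gIm,
         partial_sum kRe @ totally --> gRe,
         partial_sum kIm @ totally --> gIm,
         {ae P, forall w, Ipq f w = I gRe w +i* I gIm w} &
         forall hRe hIm : T, sym_power T hRe -> sym_power T hIm ->
           {ae P, forall w, Ipq f w = I hRe w +i* I hIm w} ->
           hRe = gRe /\ hIm = gIm]).
Proof.
move=> _ _ Yiso _ hermiteP JP hI hC e_orth e_norm Sf _ cf u v kRe kIm.
pose t (m : multi_index_of p * multi_index_of q) : Tpq :=
  tprod (symm_seq Tp (mi_seq e (val m.1)))
        (symm_seq Tq (mi_seq (cplx_conj \o e) (val m.2))).
have rep A : represents P I Ipq (partial_sum (fun m => c m.1 m.2 *: t m) A)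
    (partial_sum kRe A) (partial_sum kIm A).
  rewrite !partial_sumE; apply: (represents_sum hI hC) => m _.
  exact: (represents_basis Yiso hermiteP JP hI hC e_orth e_norm
    (valP m.1) (valP m.2)).
have [cvRe cvIm] := represents_cauchy hI hC rep cf.
set gRe := lim (partial_sum kRe @ totally) in cvRe.
set gIm := lim (partial_sum kIm @ totally) in cvIm.
have repf := represents_limit hI hC rep cf cvRe cvIm Sf.
have [_ SgRe SgIm Ef] := repf.
(* Partial sums over singletons show that each single kernel is a symmetric tensor, as the termwise
   L2 condition demands. *)
have rep1 m : represents P I Ipq (c m.1 m.2 *: t m) (kRe m) (kIm m).
  have := rep [fset m]%fset.
  by rewrite !partial_sumE !big_seq_fset1.
split.
  exists (I gRe), (I gIm); split => //.
  - by apply: (wiener_ito_L2_sum hI) => // m; have [] := rep1 m.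
  - by apply: (wiener_ito_L2_sum hI) => // m; have [] := rep1 m.
exists gRe, gIm; split => // hRe hIm ShRe ShIm Eh.
have E : {ae P, forall w, I hRe w = I gRe w /\ I hIm w = I gIm w}.
  by apply: filterS2 Ef Eh => w -> [].
by split; apply: (wiener_ito_inj hI) => //; apply: filterS E => w [].
Qed.
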